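(* Let $\hat H=\sum_{\bm R\in\Lambda}\hat H_{\bm R}$ be a $\mathrm{U}(1)$-symmetric free-fermion Hamiltonian on the periodic lattice $\Lambda=(\mathbb Z/L)^d$ with $N$ orbitals per unit cell, with local terms $\hat H_{\bm R}=\hat{\bm c}^\dagger h_{\bm R}\hat{\bm c}+C_{\bm R}$ of range $r$, where $L>2(2r+1)$. Assume that $\hat H$ is invariant under all lattice translations (the individual $\hat H_{\bm R}$ need not be translates of one another) and that $\hat H=\sum_{\bm R}\hat H_{\bm R}$ is frustration-free. Let $H_{\bm k}$, $\bm k\in(\mathbb R/2\pi\mathbb Z)^d$, be the $N\times N$ Bloch Hamiltonian matrix of $\hat H$, and let $E_1(\bm k)\le\dots\le E_N(\bm k)$ be its eigenvalues. Then every band $n$ satisfies either $E_n(\bm k)\ge 0$ for all $\bm k$ or $E_n(\bm k)\le 0$ for all $\bm k$, and whenever $E_n(\bm k_0)=0$ for some $\bm k_0$, one has $$E_n(\bm k)=O(|\bm k-\bm k_0|^2)\qquad\text{as }\bm k\to\bm k_0 .$$ That is, any touching of a band with the zero-energy level (and hence any touching between the valence bands $E_n\le 0$ and the conduction bands $E_n\geq 0$) is quadratic or softer.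
   Context: Fermionic modes $\hat c_{\bm R\tau}$, $\bm R\in\Lambda$, $\tau=1,\dots,N$, satisfy the canonical anticommutation relations $\{\hat c_{\bm R\tau},\hat c_{\bm R'\tau'}^\dagger\}=\delta_{\bm R,\bm R'}\delta_{\tau,\tau'}$, $\{\hat c_{\bm R\tau},\hat c_{\bm R'\tau'}\}=0$ on the fermionic Fock space; $\hat{\bm c}$ is the column vector of all of them. Each $h_{\bm R}$ is a Hermitian matrix with $(h_{\bm R})_{\bm R'\tau,\bm R''\tau'}=0$ whenever $|\bm R'-\bm R|>r$ or $|\bm R''-\bm R|>r$, where $|\cdot|$ is the maximum-norm distance on the periodic lattice and $r$ is a non-negative integer; $C_{\bm R}\in\mathbb R$. The translation by $\bm R'$ acts by $\hat c_{\bm R\tau}\mapsto\hat c_{\bm R+\bm R'\,\tau}$. Frustration-free: writing $E_{\bm R}^{\min}$ for the smallest eigenvalue of $\hat H_{\bm R}$ on Fock space, there is a nonzero vector $|\Phi\rangle$ with $\hat H_{\bm R}|\Phi\rangle=E^{\min}_{\bm R}|\Phi\rangle$ for all $\bm R$ simultaneously. Bloch Hamiltonian: put $h=\sum_{\bm R}h_{\bm R}$. By translation invariance $h_{\bm R'\tau,\bm R''\tau'}=t_{\tau\tau'}(\bm R'-\bm R'')$, where $t(\bm d)=0$ unless $\bm d$ has a (unique, since $L>4r$) representative in $\{-2r,\dots,2r\}^d$. Then $(H_{\bm k})_{\tau\tau'}=\sum_{\bm d\in\{-2r,\dots,2r\}^d}e^{-i\bm k\cdot\bm d}\,t_{\tau\tau'}(\bm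 d)$, a matrix of Laurent polynomials in $e^{ik_1},\dots,e^{ik_d}$, regarded as a function of continuous $\bm k$. The single-particle zero of energy is the one fixed by the given $h_{\bm R}$ (the chemical potential is included in $h_{\bm R}$). *)

(* Defs.v *)
From HB Require Import structures.
From mathcomp Require Import all_boot all_order all_algebra.
From mathcomp Require Import sesquilinear spectral.
From mathcomp Require Import all_classical all_reals all_analysis.
From mathcomp Require Import complex ring.
Set Implicit Arguments.
Unset Strict Implicit.
Unset Printing Implicit Defensive.
Import Order.TTheory GRing.Theory Num.Theory.
Import numFieldNormedType.Exports.
Local Open Scope ring_scope.
Local Open Scope sesquilinear_scope.

Section Fock.
Variables (C : numClosedFieldType) (n : nat).

Definition fock_dim := #|{set 'I_n}|.

(* The Fock space of n modes is 'cV[C]_(fock_dim), with basis the Slater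
   determinants |S> = c^dag_(i1) ... c^dag_(ik) |vac>, S = {i1 < ... < ik}:
   c_i |T> = (-1)^#{j in T | j < i} |T :\ i> if i \in T, and 0 otherwise. *)
Definition annih (i : 'I_n) : 'M[C]_fock_dim :=
  \matrix_(a, b) let S : {set 'I_n} := enum_val a in
                 let T : {set 'I_n} := enum_val b in
    if (i \in T) && (S == T :\ i)
    then (-1) ^+ #|[set j in T | (j < i)%N]| else 0.

Implicit Types (i j : 'I_n) (S T : {set 'I_n}).
Local Notation sg i T := ((-1) ^+ #|[set j in T | (j < i)%N]| : C).
Local Notation c := annih.

Lemma annih_rank i S T : c i (enum_rank S) (enum_rank T) =
  if (i \in T) && (S == T :\ i) then sg i T else 0.
Proof. by rewrite mxE /= !enum_rankK. Qed.

Lemma creat_rank i S T : ((c i)^t*) (enum_rank S) (enum_rank T) =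
  if (i \notin T) && (S == i |: T) then sg i T else 0.
Proof.
rewrite !mxE /= !enum_rankK.
have -> : (i \in S) && (T == S :\ i) = (i \notin T) && (S == i |: T).
  apply/andP/andP => -[iS /eqP ->].
    by rewrite finset.setD11 finset.setD1K.
  by rewrite finset.setU11 (finset.setU1K iS) eqxx.
case: ifP => [/andP[iT /eqP->]|_]; last by rewrite rmorph0.
rewrite rmorphXn rmorphN1; congr (_ ^+ #|pred_of_set _|).
apply/finset.setP=> j; rewrite !inE; case: eqVneq => // ->.
by rewrite ltnn (negPf iT).
Qed.

Lemma sum_rank (F : 'I_fock_dim -> C) : \sum_a F a = \sum_T F (enum_rank T).
Proof.
rewrite (reindex (@enum_rank {set 'I_n})) //=.
by exists enum_val => x _; rewrite ?enum_valK ?enum_rankK.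
Qed.

Lemma mul_annih p (A : 'M[C]_(p, _)) i a T :
  (A *m c i) a (enum_rank T) =
  if i \in T then sg i T * A a (enum_rank (T :\ i)) else 0.
Proof.
rewrite mxE sum_rank (bigD1 (T :\ i)) //= big1 ?addr0.
  by rewrite annih_rank eqxx andbT mulrC; case: ifP => // _; rewrite mul0r.
by move=> X nX; rewrite annih_rank (negPf nX) andbF mulr0.
Qed.

Lemma mul_creat p (A : 'M[C]_(p, _)) i a T :
  (A *m (c i)^t*) a (enum_rank T) =
  if i \notin T then sg i T * A a (enum_rank (i |: T)) else 0.
Proof.
rewrite mxE sum_rank (bigD1 (i |: T)) //= big1 ?addr0.
  by rewrite creat_rank eqxx andbT mulrC; case: ifP => // _; rewrite mul0r.
by move=> X nX; rewrite creat_rank (negPf nX) andbF mulr0.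
Qed.

Lemma sgD i j T : j \in T -> sg i T = sg i (T :\ j) * (-1) ^+ (j < i)%N.
Proof.
move=> jT; rewrite -exprD; congr (_ ^+ _); rewrite (cardsD1 j) inE jT addnC.
by congr (#|pred_of_set _| + _)%N; apply/finset.setP=> k; rewrite !inE andbA.
Qed.

Lemma sgU i j T : j \notin T -> sg i (j |: T) = sg i T * (-1) ^+ (j < i)%N.
Proof.
move=> jT; rewrite (@sgD i j (j |: T)); last by rewrite finset.setU11.
by rewrite (finset.setU1K jT).
Qed.

Lemma signs i j : i != j -> (-1) ^+ (j < i)%N = - (-1) ^+ (i < j)%N :> C.
Proof. by rewrite neq_ltn => /orP[] h; rewrite h ltnNge ltnW //= ?opprK. Qed.

(* Canonical anticommutation relations. *)
Lemma annih_anticomm i j : c i *m c j + c j *m c i = 0.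
Proof.
apply/matrixP => a b; rewrite -(enum_valK a) -(enum_valK b).
move: (enum_val a) (enum_val b) => S T; rewrite [LHS]mxE [RHS]mxE.
rewrite !mul_annih !annih_rank !inE.
have [->|ij] := eqVneq i j.
  by rewrite /=; case: ifP; rewrite ?mulr0 addr0.
rewrite /=; case: (boolP (j \in T)) => jT; case: (boolP (i \in T)) => iT;
  rewrite ?mulr0 ?addr0 //=.
have -> : (T :\ j :\ i) = T :\ i :\ j.
  by apply/finset.setP=> k; rewrite !inE andbCA.
case: ifP => _; rewrite ?mulr0 ?addr0 //.
rewrite (sgD j iT) (sgD i jT) (signs ij).
by move: (sg i (T :\ j)) (sg j (T :\ i)) ((-1) ^+ (i < j)%N) => x y z; ring.
Qed.

Lemma annih_creat_anticomm i j :
  c i *m (c j)^t* + (c j)^t* *m c i = (i == j)%:R%:M.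
Proof.
apply/matrixP => a b; rewrite -(enum_valK a) -(enum_valK b).
move: (enum_val a) (enum_val b) => S T.
rewrite mxE mul_creat mul_annih annih_rank creat_rank.
rewrite [RHS]mxE (inj_eq enum_rank_inj) !inE.
have [->|ij] /= := eqVneq i j.
  rewrite /=; have [jT|jT] := boolP (j \in T); rewrite ?add0r ?addr0 /=.
    rewrite (finset.setD1K jT) (sgD j jT) ltnn mulr1.
    by case: eqP => _; rewrite ?mulr0 -?expr2 ?sqrr_sign ?mulr0n ?mulr1n.
  rewrite (finset.setU1K jT) /= (sgU j jT) ltnn mulr1.
  by case: eqP => _; rewrite ?mulr0 -?expr2 ?sqrr_sign ?mulr0n ?mulr1n.
rewrite mul0rn /=.
case: (boolP (j \in T)) => jT; case: (boolP (i \in T)) => iT;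
  rewrite ?mulr0 ?addr0 //=.
have -> : (j |: T) :\ i = j |: T :\ i.
  apply/finset.setP=> k; rewrite !inE.
  by case: (eqVneq k j) => //= ->; rewrite eq_sym ij.
case: ifP => _; rewrite ?mulr0 ?addr0 //.
rewrite (sgU i jT) (sgD j iT) (signs ij).
have := sqrr_sign C (i < j)%N.
move: (sg i T) (sg j (T :\ i)) ((-1) ^+ (i < j)%N) => x y z z2.
by have -> : x * y = x * y * z ^+ 2; [rewrite z2 mulr1 | ring].
Qed.

(* c^dag A c + c0; the family c is a parameter so that a symmetry acting by
   substitution on the modes can be applied to the Hamiltonian. *)
Definition bilinear_op (c : 'I_n -> 'M[C]_fock_dim) (A : 'M[C]_n) (c0 : C) :
    'M[C]_fock_dim :=
  \sum_(i < n) \sum_(j < n) A i j *: ((c i)^t* *m c j) + c0%:M.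

End Fock.

(* eigenvalue is the row-vector notion; it has the same spectrum as the action
   on column vectors. *)
Definition min_eigenvalue (C : numClosedFieldType) (p : nat)
    (A : 'M[C]_p) (e : C) : Prop :=
  eigenvalue A e /\ forall e', eigenvalue A e' -> e <= e'.

Definition frustration_free (C : numClosedFieldType) (I : Type) (p : nat)
    (H : I -> 'M[C]_p) : Prop :=
  exists2 Phi : 'cV[C]_p, Phi != 0 &
    forall x : I, exists2 e, min_eigenvalue (H x) e & H x *m Phi = e *: Phi.

(* E lists the eigenvalues of A with algebraic multiplicity, in nondecreasing
   order; this determines E. *)
Definition ordered_spectrum (R : rcfType) (p : nat) (A : 'M[R[i]]_p)
    (E : 'I_p -> R) : Prop :=
  (forall i j : 'I_p, (i <= j)%N -> E i <= E j) /\
  char_poly A = \prod_(i < p) ('X - ((E i)%:C)%C%:P).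

Section Lattice.
Variables (L d N : nat).

(* 'Z_L is Z/L only for 1 < L. *)
Definition lattice := 'rV['Z_L]_d.

Definition torus_norm (x : lattice) : nat :=
  \max_(j < d) minn (x ord0 j) (L - x ord0 j).

Definition modes := (lattice * 'I_N)%type.

Definition nmodes := #|{: modes}|.

Definition mode (x : lattice) (tau : 'I_N) : 'I_nmodes :=
  enum_rank ((x, tau) : modes).

Definition translate_mode (a : lattice) (i : 'I_nmodes) : 'I_nmodes :=
  mode ((enum_val i).1 + a) (enum_val i).2.

Definition has_range (C : nzRingType) (r : nat) (x : lattice)
    (A : 'M[C]_nmodes) : Prop :=
  forall (y z : lattice) (tau tau' : 'I_N),
    (r < torus_norm (y - x)%R)%N || (r < torus_norm (z - x)%R)%N ->
    A (mode y tau) (mode z tau') = 0.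

Section Hamiltonian.
Variable R : realType.
Variables (h : lattice -> 'M[R[i]]_nmodes) (C : lattice -> R).

Definition term_of (c : 'I_nmodes -> 'M[R[i]]_(fock_dim nmodes))
    (x : lattice) : 'M[R[i]]_(fock_dim nmodes) :=
  bilinear_op c (h x) ((C x)%:C)%C.

Definition local_term (x : lattice) : 'M[R[i]]_(fock_dim nmodes) :=
  term_of (@annih _ nmodes) x.

Definition translation_invariant : Prop :=
  forall a : lattice,
    \sum_x term_of (fun i => annih R[i] (translate_mode a i)) x
    = \sum_x local_term x.

(* t(x), read off with the second site at the origin; for a translation
   invariant Hamiltonian any other second site gives the same value. *)
Definition hopping (x : lattice) (tau tau' : 'I_N) : R[i] :=
  (\sum_y h y) (mode x tau) (mode 0 tau').

(* The integer vectors in {-2r, ..., 2r}^d. *)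
Definition displacement (r : nat) (delta : {ffun 'I_d -> 'I_(4 * r).+1})
    (j : 'I_d) : int := (delta j)%:Z - (2 * r)%:Z.

Definition exp_mi (theta : R) : R[i] := (cos theta -i* sin theta)%C.

Definition bloch (r : nat) (k : 'rV[R]_d) : 'M[R[i]]_N :=
  \matrix_(tau, tau') \sum_(delta : {ffun 'I_d -> 'I_(4 * r).+1})
    exp_mi (\sum_(j < d) k 0 j * (displacement delta j)%:~R)
    * hopping (\row_j (displacement delta j)%:~R) tau tau'.

End Hamiltonian.
End Lattice.

(* Main.v *)
(* In a common ground state every positive single-particle level of every h_x is
   empty and every negative one is filled, so the canonical anticommutation
   relations make them orthogonal: h_x = F_x F_x^* - G_x G_x^* with G_y^* F_x = 0
   for all x and y. Hence sum_x F_x F_x^* and sum_x G_x G_x^* are the positive and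
   negative parts of the translation invariant matrix sum_x h_x, and F_x stays
   orthogonal to all translates of G_y. Bloch waves turn this into
   H_k = A_k - B_k with A_k, B_k sums of squares and A_k B_k = 0 for every real k.
   The ranks of A_k and B_k attain their maxima at a common k, and there they add
   up to at most N, so a band cannot take both signs. If E_n(k0) = 0, vectors in
   the kernel of A_k0 are killed by every F_x(k0), so they have A_k-energy
   O(|k - k0|^2); the minimax principle bounds E_n(k) from above by this energy,
   and B_k gives the lower bound. *)
Require Import Defs.
From HB Require Import structures.
From mathcomp Require Import all_boot all_order all_algebra all_fingroup.
From mathcomp Require Import sesquilinear spectral.
From mathcomp Require Import all_classical all_reals all_analysis.
From mathcomp Require Import complex zify ring lra.
Import Order.TTheory GRing.Theory Num.Theory.
Import numFieldNormedType.Exports.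
Local Open Scope classical_set_scope.
Local Open Scope ring_scope.
Local Open Scope sesquilinear_scope.
Set Implicit Arguments.
Unset Strict Implicit.
Unset Printing Implicit Defensive.

(** * Linear algebra *)

Section Frobenius.
Variable C : numClosedFieldType.

Lemma adjmxM m n p (A : 'M[C]_(m, n)) (B : 'M[C]_(n, p)) :
  (A *m B)^t* = B^t* *m A^t*.
Proof. by rewrite trmx_mul map_mxM. Qed.

Lemma adjmxD m n (A B : 'M[C]_(m, n)) : (A + B)^t* = A^t* + B^t*.
Proof. by rewrite linearD /= map_mxD. Qed.

Lemma adjmxB m n (A B : 'M[C]_(m, n)) : (A - B)^t* = A^t* - B^t*.
Proof. by rewrite linearB /= map_mxB. Qed.

Lemma adjmxZ m n a (A : 'M[C]_(m, n)) : (a *: A)^t* = a^* *: A^t*.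
Proof. by rewrite linearZ /= map_mxZ. Qed.

Lemma adjmx_sum (I : finType) m n (A : I -> 'M[C]_(m, n)) :
  (\sum_i A i)^t* = \sum_i (A i)^t*.
Proof. by rewrite linear_sum /= map_mx_sum. Qed.

Lemma hermsymP n (A : 'M[C]_n) : reflect (A^t* = A) (A \is hermsymmx).
Proof.
apply: (iffP (is_hermitianmxP _ _ _)); rewrite expr0 scale1r => {1}->//.
by rewrite trmxCK.
Qed.

(** The squared Frobenius norm, kept in [C] so that it compares directly with traces and quadratic
    forms. *)
Definition sqnorm m n (A : 'M[C]_(m, n)) : C := \sum_i \sum_j `|A i j| ^+ 2.

Lemma sqnorm_ge0 m n (A : 'M[C]_(m, n)) : 0 <= sqnorm A.
Proof. by apply: sumr_ge0 => i _; apply: sumr_ge0 => j _; apply: exprn_ge0. Qed.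

Lemma sqnorm_le m n (A : 'M[C]_(m, n)) i j : `|A i j| ^+ 2 <= sqnorm A.
Proof.
rewrite /sqnorm (bigD1 i) //= (bigD1 j) //= -addrA lerDl addr_ge0 //.
  by apply: sumr_ge0 => k _; apply: exprn_ge0.
by apply: sumr_ge0 => k _; apply: sumr_ge0 => l _; apply: exprn_ge0.
Qed.

Lemma sqnorm_eq0 m n (A : 'M[C]_(m, n)) : (sqnorm A == 0) = (A == 0).
Proof.
apply/eqP/eqP => [A0|->]; last first.
  by apply: big1 => i _; apply: big1 => j _; rewrite mxE normr0 expr0n.
apply/matrixP => i j; rewrite mxE; apply/eqP.
rewrite -normr_eq0 -[_ == 0](@expf_eq0 _ _ 2) eq_le exprn_ge0 // andbT.
by rewrite -A0 sqnorm_le.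
Qed.

Lemma mxtrace_mul_adj m n (A : 'M[C]_(m, n)) : \tr (A *m A^t*) = sqnorm A.
Proof.
apply: eq_bigr => i _; rewrite mxE; apply: eq_bigr => j _.
by rewrite !mxE -normCK.
Qed.

Lemma quad_gram n p (u : 'rV[C]_n) (F : 'M[C]_(n, p)) :
  (u *m (F *m F^t*) *m u^t*) 0 0 = sqnorm (u *m F).
Proof. by rewrite -mxtrace_mul_adj adjmxM [RHS]trace_mx11 !mulmxA. Qed.

(** Each entry of [u *m K] is at most n c e times the norm of [u]. The constant is crude; what
    matters is the factor [e ^+ 2], with [e] later the distance between two momenta. *)
Lemma sqnorm_mul_le n p (u : 'rV[C]_n) (K : 'M[C]_(n, p)) (c e : C) :
  (forall i j, `|K i j| <= c * e) ->
  sqnorm (u *m K) <= p%:R * (n%:R * c) ^+ 2 * e ^+ 2 * sqnorm u.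
Proof.
move=> Kle; rewrite {1}/sqnorm big_ord1.
have u_le i : `|u 0 i| <= sqrtC (sqnorm u).
  rewrite -(@ler_pXn2r _ 2) ?nnegrE ?sqrtC_ge0 ?sqnorm_ge0 //.
  by rewrite sqrtCK sqnorm_le.
have entry j : `|(u *m K) 0 j| <= n%:R * c * e * sqrtC (sqnorm u).
  rewrite mxE; apply: le_trans (ler_norm_sum _ _ _) _.
  have -> : n%:R * c * e * sqrtC (sqnorm u)
      = \sum_(i < n) sqrtC (sqnorm u) * (c * e).
    by rewrite sumr_const card_ord -mulr_natl; ring.
  by apply: ler_sum => i _; rewrite normrM ler_pM.
apply: le_trans (_ : \sum_(j < p) (n%:R * c * e * sqrtC (sqnorm u)) ^+ 2 <= _).
  by apply: ler_sum => j _; rewrite lerXn2r ?nnegrE // (le_trans _ (entry j)).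
rewrite [leLHS](_ : _ = p%:R * (n%:R * c) ^+ 2 * e ^+ 2 * sqnorm u) //.
by rewrite sumr_const card_ord -mulr_natl -{2}[sqnorm u]sqrtCK; ring.
Qed.

Lemma quadB n (u : 'rV[C]_n) (A B : 'M[C]_n) :
  (u *m (A - B) *m u^t*) 0 0 = (u *m A *m u^t*) 0 0 - (u *m B *m u^t*) 0 0.
Proof. by rewrite mulmxBr mulmxBl [LHS]mxE [X in _ + X = _]mxE. Qed.

(** * Uniqueness of orthogonal Gram splittings *)

Section SplitUniqueness.
Variables (I : finType) (n p : nat).
Implicit Types F G : I -> 'M[C]_(n, p).

Definition gram F : 'M[C]_n := \sum_x F x *m (F x)^t*.

Lemma gram_adj F : (gram F)^t* = gram F.
Proof.
by rewrite adjmx_sum; apply: eq_bigr => x _; rewrite adjmxM trmxCK.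
Qed.

Lemma quad_gram_sum F (u : 'rV[C]_n) :
  (u *m gram F *m u^t*) 0 0 = \sum_x sqnorm (u *m F x).
Proof.
rewrite mulmx_sumr mulmx_suml summxE.
by apply: eq_bigr => x _; rewrite quad_gram.
Qed.

Lemma mulmx_gram_eq0 F (u : 'rV[C]_n) x : u *m gram F = 0 -> u *m F x = 0.
Proof.
move=> u0; have := quad_gram_sum F u; rewrite u0 mul0mx mxE => /esym/eqP.
rewrite psumr_eq0 => [/allP/(_ x)|y _]; last exact: sqnorm_ge0.
by rewrite mem_index_enum sqnorm_eq0 => /(_ isT)/eqP.
Qed.

Lemma gram_mul0 F G : (forall x y, (G x)^t* *m F y = 0) -> gram G *m gram F = 0.
Proof.
move=> GF; rewrite mulmx_suml big1 // => x _; rewrite mulmx_sumr big1 // => y _.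
by rewrite -mulmxA [(G x)^t* *m _]mulmxA GF mul0mx mulmx0.
Qed.

Lemma mxtrace_gramM F G :
  \tr (gram F *m gram G) = \sum_x \sum_y sqnorm ((G y)^t* *m F x).
Proof.
rewrite mulmx_suml raddf_sum; apply: eq_bigr => x _.
rewrite mulmx_sumr raddf_sum; apply: eq_bigr => y _ /=.
rewrite -mxtrace_mul_adj adjmxM trmxCK [in RHS]mxtrace_mulC.
by rewrite [in RHS]mulmxA [in RHS]mxtrace_mulC !mulmxA.
Qed.

(* With X = A - A' = B - B', the trace of X^2 is - tr(A B') - tr(A' B) <= 0. *)
Lemma gram_split_cross F G F' G' :
  gram F - gram G = gram F' - gram G' ->
  (forall x y, (G x)^t* *m F y = 0) -> (forall x y, (G' x)^t* *m F' y = 0) ->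
  forall x y, (G' x)^t* *m F y = 0.
Proof.
move=> eqH GF GF' x y.
have eqX : gram F - gram F' = gram G - gram G'.
  move/eqP: eqH; rewrite subr_eq => /eqP ->.
  by rewrite addrC -!addrA addKr addrC.
have mul0 F1 G1 : (forall x y, (G1 x)^t* *m F1 y = 0) -> gram F1 *m gram G1 = 0.
  move=> /gram_mul0 /(congr1 (fun M : 'M[C]_n => M^t*)).
  by rewrite adjmxM !gram_adj trmx0 map_mx0.
have trX : sqnorm (gram F - gram F') + \tr (gram F *m gram G')
    + \tr (gram F' *m gram G) = 0.
  rewrite -mxtrace_mul_adj adjmxB !gram_adj [X in _ *m X]eqX.
  rewrite mulmxBl !mulmxBr (mul0 _ _ GF) (mul0 _ _ GF') !raddfB /= mxtrace0.
  by ring.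
have tr_ge0 F1 G1 : 0 <= \tr (gram F1 *m gram G1).
  rewrite mxtrace_gramM; apply: sumr_ge0 => i _; apply: sumr_ge0 => j _.
  exact: sqnorm_ge0.
(* The three summands of [trX] are nonnegative, so each is zero; this one is the sum of the squared
   norms of all [(G' y)^t* *m F x]. *)
have : \tr (gram F *m gram G') = 0.
  apply/eqP; rewrite eq_le tr_ge0 andbT -trX.
  by rewrite addrAC lerDr addr_ge0 ?sqnorm_ge0 ?tr_ge0.
have ge0 i j : 0 <= sqnorm ((G' j)^t* *m F i) by exact: sqnorm_ge0.
move/eqP; rewrite mxtrace_gramM psumr_eq0 => [/allP/(_ y)|i _]; last first.
  by apply: sumr_ge0.
rewrite mem_index_enum psumr_eq0 // => /(_ isT)/allP/(_ x).
by rewrite mem_index_enum sqnorm_eq0 => /(_ isT)/eqP.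
Qed.

(** A symmetry [T] of the difference turns [F] and [G] into a second orthogonal splitting of the
    same matrix, and [gram_split_cross] compares the two. *)
Lemma gram_split_relabel F G (T : 'I_n -> 'I_n) : injective T ->
  (forall i j, (gram F - gram G) (T i) (T j) = (gram F - gram G) i j) ->
  (forall x y, (G x)^t* *m F y = 0) ->
  forall x y, (\matrix_(i, j) G x (T i) j)^t* *m F y = 0.
Proof.
move=> Tinj FGT GF.
pose tr (K : I -> 'M[C]_(n, p)) x := \matrix_(i, j) K x (T i) j.
have gramT K i j : gram (tr K) i j = gram K (T i) (T j).
  rewrite !summxE; apply: eq_bigr => x _; rewrite !mxE.
  by apply: eq_bigr => l _; rewrite !mxE.
apply: (@gram_split_cross F G (tr F) (tr G)) => // [|x y].
  apply/matrixP => i j; rewrite -FGT.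
  by rewrite [LHS]mxE [RHS]mxE [(- gram G) _ _]mxE [(- gram (tr G)) _ _]mxE !gramT.
apply/matrixP => i j; have /matrixP/(_ i j) := GF x y.
rewrite [LHS]mxE (reindex_inj Tinj) => {}GF; rewrite [LHS]mxE -[RHS]GF.
by apply: eq_bigr => l _; rewrite !mxE.
Qed.

End SplitUniqueness.

(** * Roots of the positive and negative parts of a Hermitian matrix *)

Section SpectralRoots.
Variable n : nat.
Implicit Types A : 'M[C]_n.

Lemma hermsym_spectral A : A \is hermsymmx ->
  let P := spectralmx A in let D := spectral_diag A in
  [/\ P *m P^t* = 1%:M, P^t* *m P = 1%:M, forall i, D 0 i \is Num.real
     & A = P^t* *m diag_mx D *m P].
Proof.
move=> hA P D; have PU : P \is unitarymx by exact: spectral_unitarymx.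
have PP : P *m P^t* = 1%:M by exact/unitarymxP.
split=> //; first exact: mulmx1C.
  by move=> i; apply/mxOverP/hermitian_spectral_diag_real.
rewrite -invmx_unitary //.
exact/orthomx_spectralP/hermitian_normalmx.
Qed.

(** For Hermitian [A] each column is zero or an eigenvector scaled by the root of its positive
    eigenvalue, so [posroot A *m (posroot A)^t*] is the positive part of [A]. Having eigenvectors as
    columns is what [negroot_posroot0] relies on. *)
Definition posroot A : 'M[C]_n := (spectralmx A)^t* *m
  diag_mx (\row_i if 0 < spectral_diag A 0 i then sqrtC (spectral_diag A 0 i) else 0).

Definition negroot A : 'M[C]_n := (spectralmx A)^t* *m
  diag_mx (\row_i if spectral_diag A 0 i < 0 then sqrtC (- spectral_diag A 0 i) else 0).

Lemma posrootE A i j : posroot A i j = (spectralmx A)^t* i j *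
  if 0 < spectral_diag A 0 j then sqrtC (spectral_diag A 0 j) else 0.
Proof. by rewrite /posroot mul_mx_diag !mxE. Qed.

Lemma negrootE A i j : negroot A i j = (spectralmx A)^t* i j *
  if spectral_diag A 0 j < 0 then sqrtC (- spectral_diag A 0 j) else 0.
Proof. by rewrite /negroot mul_mx_diag !mxE. Qed.

Lemma hermsym_split A : A \is hermsymmx ->
  A = posroot A *m (posroot A)^t* - negroot A *m (negroot A)^t*.
Proof.
move=> hA; have [_ _ Dr {1}->] := hermsym_spectral hA.
rewrite /posroot /negroot !adjmxM trmxCK !mulmxA -mulmxBl; congr (_ *m _).
rewrite -![_ *m diag_mx _ *m _]mulmxA -mulmxBr; congr (_ *m _).
rewrite !tr_diag_mx !map_diag_mx !mulmx_diag -raddfB /=; congr diag_mx.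
apply/rowP => i; rewrite !mxE; set x := spectral_diag A 0 i.
have sq (y : C) : 0 <= y -> sqrtC y * (sqrtC y)^* = y.
  by move=> y0; rewrite -normCK ger0_norm ?sqrtC_ge0 // sqrtCK.
have: x \is Num.real by exact: Dr.
case/real_ltgt0P => [x0|x0|->].
- by rewrite sq ?ltW // rmorph0 mulr0 subr0.
- by rewrite sq ?oppr_ge0 ?ltW // mul0r sub0r opprK.
- by rewrite mul0r subr0.
Qed.

Lemma spectral_col A i : A \is hermsymmx ->
  A *m col i ((spectralmx A)^t*)
  = spectral_diag A 0 i *: col i ((spectralmx A)^t*).
Proof.
move=> hA; have [PP _ _ {1}->] := hermsym_spectral hA.
rewrite !colE -!mulmxA [spectralmx A *m (_ *m _)]mulmxA PP mul1mx mulmxA -!colE.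
by apply/colP => k; rewrite mxE mul_mx_diag !mxE mulrC.
Qed.

Lemma negroot_posroot0 A B : A \is hermsymmx -> B \is hermsymmx ->
  (forall (l m : C) (v w : 'cV_n), 0 < l -> m < 0 ->
     A *m v = l *: v -> B *m w = m *: w -> w^t* *m v = 0) ->
  (negroot B)^t* *m posroot A = 0.
Proof.
move=> hA hB AB; apply/matrixP => i j.
rewrite /posroot /negroot adjmxM trmxCK -mulmxA [X in _ *m X]mulmxA tr_diag_mx map_diag_mx.
rewrite mul_diag_mx mul_mx_diag !mxE.
case: ifP => m0; last by rewrite rmorph0 mul0r.
case: ifP => l0; last by rewrite !mulr0.
have := AB _ _ _ _ l0 m0 (spectral_col j hA) (spectral_col i hB).
move/matrixP/(_ 0 0); rewrite !mxE => H.
rewrite [X in _ * (X * _)](_ : _ = 0) ?mul0r ?mulr0 //.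
apply: etrans H; apply: eq_bigr => k _; by rewrite !mxE conjCK.
Qed.

(** An eigenvector with nonzero eigenvalue lies in the column space of [A], so it vanishes in every
    coordinate where the row of [A] is zero. This passes the finite range of a local term on to its
    roots. *)
Lemma row_root_eq0 A i : A \is hermsymmx -> row i A = 0 ->
  row i (posroot A) = 0 /\ row i (negroot A) = 0.
Proof.
move=> hA Ai; have [PP _ _ eA] := hermsym_spectral hA.
have PD j : (spectralmx A)^t* i j * spectral_diag A 0 j = 0.
  have /rowP/(_ j) : row i (A *m (spectralmx A)^t*) = 0 by rewrite row_mul Ai mul0mx.
  by rewrite {1}eA -mulmxA PP mulmx1 mxE mul_mx_diag !mxE.
split; apply/rowP => j; rewrite [LHS]mxE [RHS]mxE ?posrootE ?negrootE; case: ifP => l0;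
  rewrite ?mulr0 //.
  by have /eqP := PD j; rewrite mulf_eq0 (gt_eqF l0) orbF => /eqP->; rewrite mul0r.
by have /eqP := PD j; rewrite mulf_eq0 (lt_eqF l0) orbF => /eqP->; rewrite mul0r.
Qed.

End SpectralRoots.

(** [S] meets the left kernel of [A] only in zero, so multiplication by [A] preserves its
    dimension. *)
Lemma pos_form_rank m n (S : 'M[C]_(m, n)) (A : 'M[C]_n) :
  (forall u : 'rV_n, (u <= S)%MS -> u != 0 -> u *m A != 0) ->
  (\rank S <= \rank A)%N.
Proof.
move=> SA; have /eqP : (S :&: kermx A)%MS = 0.
  apply/eqP/rowV0P => u; rewrite sub_capmx => /andP[uS /sub_kermxP uA].
  by apply/eqP; apply: contraT => /(SA _ uS); rewrite uA eqxx.
rewrite -mxrank_eq0 => /eqP S0.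
have := mxrank_mul_ker S A; rewrite S0 addn0 => <-; exact: mxrankM_maxr.
Qed.

Lemma rank_cap_gt0 m1 m2 n (S : 'M[C]_(m1, n)) (T : 'M[C]_(m2, n)) :
  (n < \rank S + \rank T)%N ->
  exists2 u : 'rV_n, u != 0 & (u <= S)%MS && (u <= T)%MS.
Proof.
move=> ST; suff : (S :&: T)%MS != 0.
  by case/rowV0Pn => u uST u0; exists u; rewrite // -sub_capmx.
rewrite -mxrank_eq0 -lt0n -(ltn_add2l (\rank (S + T)%MS)) addn0.
by rewrite mxrank_sum_cap (leq_ltn_trans (rank_leq_col _)).
Qed.

End Frobenius.

(** * Variational description of the ordered eigenvalues *)

Section OrderedSpectrum.
Variables (R : rcfType) (n : nat).
Implicit Types (H : 'M[R[i]]_n) (E : 'I_n -> R).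

Lemma char_poly_unitary_conj (P A : 'M[R[i]]_n) : P^t* *m P = 1%:M ->
  char_poly (P^t* *m A *m P) = char_poly A.
Proof.
move=> PP; rewrite /char_poly.
have -> : char_poly_mx (P^t* *m A *m P) =
    map_mx polyC (P^t*) *m char_poly_mx A *m map_mx polyC P.
  rewrite /char_poly_mx mulmxBr mulmxBl !map_mxM /=; congr (_ - _).
  by rewrite -mulmxA mul_scalar_mx -scalemxAr -map_mxM PP /= map_mx1 scalemx1.
rewrite !det_mulmx mulrAC -det_mulmx -map_mxM PP /= map_mx1 det1 mul1r.
by [].
Qed.

(** The spectral theorem lists the eigenvalues in an order of its own. Both lists are the roots of
    one characteristic polynomial, so they differ by a permutation, which is applied to the rows of
    the diagonalising matrix. *)
Lemma ordered_spectrum_diag H E : H \is hermsymmx -> ordered_spectrum H E ->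
  exists Q, [/\ Q *m Q^t* = 1%:M, Q^t* *m Q = 1%:M
    & H = Q^t* *m diag_mx (\row_i (E i)%:C%C) *m Q].
Proof.
move=> hH [_ chE]; have [PP PP' _ eH] := hermsym_spectral hH.
set P := spectralmx H in PP PP' eH; set D := spectral_diag H in eH.
have chD : char_poly H = \prod_i ('X - (D 0 i)%:P).
  rewrite eH char_poly_unitary_conj // char_poly_trig ?diag_mx_is_trig //.
  by apply: eq_bigr => i _; rewrite mxE eqxx mulr1n.
have /tuple_permP[s sE] :
    perm_eq [tuple (E i)%:C%C | i < n] [tuple D 0 i | i < n].
  apply: prod_XsubC_eq; rewrite !big_tuple.
  by transitivity (char_poly H); [rewrite chE|rewrite chD]; apply: eq_bigr => i _;
    rewrite tnth_mktuple.
have {}sE i : (E i)%:C%C = D 0 (s i).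
  have := congr1 (fun t => nth 0 t i) sE.
  by rewrite -!tnth_nth !tnth_mktuple.
have QQ : row_perm s P *m (row_perm s P)^t* = 1%:M.
  apply/matrixP => i j; have /matrixP/(_ (s i) (s j)) := PP.
  rewrite !mxE (inj_eq perm_inj) => <-; apply: eq_bigr => k _.
  by rewrite !mxE.
exists (row_perm s P); split=> //; first exact: mulmx1C.
rewrite eH; apply/matrixP => i j; rewrite !mxE.
rewrite (reindex_inj (@perm_inj _ s)) /=; apply: eq_bigr => k _.
by rewrite !mul_mx_diag !mxE -sE.
Qed.

Lemma diag_quad (u w : 'rV[R[i]]_n) (Q : 'M[R[i]]_n) E : Q *m Q^t* = 1%:M -> u = w *m Q ->
  (u *m (Q^t* *m diag_mx (\row_i (E i)%:C%C) *m Q) *m u^t*) 0 0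
  = \sum_i (E i)%:C%C * `|w 0 i| ^+ 2.
Proof.
move=> QQ ->; rewrite adjmxM -!mulmxA [Q *m (Q^t* *m _)]mulmxA QQ mul1mx.
rewrite [Q *m (Q^t* *m _)]mulmxA QQ mul1mx mulmxA mxE.
by apply: eq_bigr => i _; rewrite mul_mx_diag !mxE normCK mulrAC mulrC.
Qed.

Lemma sqnorm_unitary (w : 'rV[R[i]]_n) (Q : 'M[R[i]]_n) : Q *m Q^t* = 1%:M ->
  sqnorm (w *m Q) = \sum_i `|w 0 i| ^+ 2.
Proof.
move=> QQ; rewrite -mxtrace_mul_adj adjmxM !mulmxA -[w *m Q *m _]mulmxA QQ mulmx1.
by rewrite mxtrace_mul_adj /sqnorm big_ord1.
Qed.

(* Courant-Fischer, as a pair of subspaces of complementary dimensions plus one. *)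
Lemma low_energy_space H E (k : 'I_n) : H \is hermsymmx -> ordered_spectrum H E ->
  exists S : 'M[R[i]]_n, \rank S = k.+1 /\
    forall u : 'rV_n, (u <= S)%MS ->
      (u *m H *m u^t*) 0 0 <= (E k)%:C%C * sqnorm u.
Proof.
move=> hH HE; have [Q [QQ QQ' eH]] := ordered_spectrum_diag hH HE.
exists (pid_mx k.+1 *m Q); split.
  by rewrite mxrankMfree ?rank_pid_mx // row_free_unit; case/mulmx1_unit: QQ.
move=> u /submxP[w0]; rewrite mulmxA; set w := _ *m pid_mx _ => uw.
have w0i (i : 'I_n) : (k < i)%N -> w 0 i = 0.
  move=> ki; rewrite !mxE big1 // => j _.
  by rewrite mxE; case: eqVneq => [->|]; rewrite ?mulr0 // ltnS leqNgt ki mulr0.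
rewrite {1}eH (diag_quad _ QQ uw) uw sqnorm_unitary // mulr_sumr.
apply: ler_sum => i _; have [ik|ki] := leqP i k; last first.
  by rewrite w0i // normr0 expr0n !mulr0.
by rewrite ler_wpM2r ?exprn_ge0 // lecR; case: HE => + _; apply.
Qed.

(** Spanned by the eigenvectors from index [k] on. It meets the low-energy space of any other matrix
    at the same index, since the dimensions add up to n + 1. *)
Lemma high_energy_space H E (k : 'I_n) : H \is hermsymmx -> ordered_spectrum H E ->
  exists S : 'M[R[i]]_n, \rank S = (n - k)%N /\
    forall u : 'rV_n, (u <= S)%MS ->
      (E k)%:C%C * sqnorm u <= (u *m H *m u^t*) 0 0.
Proof.
move=> hH HE; have [Q [QQ QQ' eH]] := ordered_spectrum_diag hH HE.
exists (copid_mx k *m Q); split.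
  rewrite mxrankMfree ?rank_copid_mx 1?ltnW // row_free_unit.
  by case/mulmx1_unit: QQ.
move=> u /submxP[w0]; rewrite mulmxA; set w := _ *m copid_mx _ => uw.
have w0i (i : 'I_n) : (i < k)%N -> w 0 i = 0.
  move=> ik; rewrite !mxE big1 // => j _.
  by rewrite !mxE -val_eqE /=; case: eqVneq => [->|_]; rewrite ?ik /= subrr mulr0.
rewrite {1}eH (diag_quad _ QQ uw) uw sqnorm_unitary // mulr_sumr.
apply: ler_sum => i _; have [ki|ik] := leqP k i; last first.
  by rewrite w0i // normr0 expr0n !mulr0.
by rewrite ler_wpM2r ?exprn_ge0 // lecR; case: HE => + _; apply.
Qed.
End OrderedSpectrum.

(** * Fermionic Fock space *)

Section Fock.
Variables (C : numClosedFieldType) (n : nat).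
Implicit Types (A : 'M[C]_n) (i j l m : 'I_n) (a : C).

(** * Commutation of bilinears with single modes *)

Section CAR.
Variable c : 'I_n -> 'M[C]_(fock_dim n).
Hypothesis cc : forall i j, c i *m c j + c j *m c i = 0.
Hypothesis ccd : forall i j, c i *m (c j)^t* + (c j)^t* *m c i = (i == j)%:R%:M.

Lemma anticomm_adj i j : (c i)^t* *m (c j)^t* + (c j)^t* *m (c i)^t* = 0.
Proof. by rewrite -!adjmxM -adjmxD cc trmx0 map_mx0. Qed.

Lemma comm_quad_annih i j l : (c i)^t* *m c j *m c l =
  c l *m ((c i)^t* *m c j) - (i == l)%:R *: c j.
Proof.
have -> : (c i)^t* *m c j *m c l = - ((c i)^t* *m c l) *m c j.
  rewrite mulNmx -!mulmxA -mulmxN; congr (_ *m _).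
  by apply/eqP; rewrite -addr_eq0 cc.
have -> : (c i)^t* *m c l = (l == i)%:R%:M - c l *m (c i)^t*.
  by rewrite -ccd addrC addKr.
by rewrite opprB mulmxBl mul_scalar_mx mulmxA eq_sym.
Qed.

Lemma comm_quad_creat i j l : (c i)^t* *m c j *m (c l)^t* =
  (c l)^t* *m ((c i)^t* *m c j) + (j == l)%:R *: (c i)^t*.
Proof.
have e1 : c j *m (c l)^t* = (j == l)%:R%:M - (c l)^t* *m c j.
  by rewrite -ccd addrK.
have e2 : (c i)^t* *m (c l)^t* = - ((c l)^t* *m (c i)^t*).
  by apply/eqP; rewrite -addr_eq0 anticomm_adj.
rewrite -mulmxA e1 mulmxBr [(c i)^t* *m (_ *m _)]mulmxA e2.
by rewrite mulNmx opprK mul_mx_scalar addrC mulmxA.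
Qed.

Lemma bilinear_op_annih A a l : bilinear_op c A a *m c l =
  c l *m bilinear_op c A a - \sum_j A l j *: c j.
Proof.
rewrite /bilinear_op mulmxDl mulmxDr -scalar_mxC addrAC; congr (_ + _).
rewrite mulmx_suml mulmx_sumr [in RHS](bigD1 l) //= [in LHS](bigD1 l) //=.
rewrite addrAC; congr (_ + _).
  rewrite mulmx_suml mulmx_sumr -sumrB; apply: eq_bigr => j _.
  by rewrite -scalemxAl comm_quad_annih eqxx scale1r scalerBr scalemxAr.
apply: eq_bigr => i il.
rewrite mulmx_suml mulmx_sumr; apply: eq_bigr => j _.
by rewrite -scalemxAl comm_quad_annih (negPf il) scale0r subr0 scalemxAr.
Qed.

Lemma bilinear_op_creat A a l : bilinear_op c A a *m (c l)^t* =
  (c l)^t* *m bilinear_op c A a + \sum_i A i l *: (c i)^t*.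
Proof.
rewrite /bilinear_op mulmxDl mulmxDr -scalar_mxC [in RHS]addrAC; congr (_ + _).
rewrite mulmx_suml mulmx_sumr -big_split; apply: eq_bigr => i _ /=.
rewrite mulmx_suml mulmx_sumr [in RHS](bigD1 l) //= [in LHS](bigD1 l) //=.
rewrite addrAC; congr (_ + _).
  by rewrite -scalemxAl comm_quad_creat eqxx scale1r scalerDr scalemxAr.
apply: eq_bigr => j il.
by rewrite -scalemxAl comm_quad_creat (negPf il) scale0r addr0 scalemxAr.
Qed.

(** The commutator of [c l] with [X] combines the [c j] with row [l] of [A] as coefficients, and the
    anticommutator with the adjoint of [c m] isolates one of them. The operator thus determines [A],
    and the constant [a] drops out. *)
Lemma bilinear_op_coef A a l m (X := bilinear_op c A a) :
  (c l *m X - X *m c l) *m (c m)^t* + (c m)^t* *m (c l *m X - X *m c l)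
  = (A l m)%:M.
Proof.
rewrite {}/X bilinear_op_annih subKr mulmx_suml mulmx_sumr -big_split /=.
rewrite (bigD1 m) //= big1 => [|j jm]; rewrite -scalemxAl -scalemxAr -scalerDr ccd.
  by rewrite eqxx addr0 scalemx1.
by rewrite (negPf jm) scale_scalar_mx mulr0 raddf0.
Qed.

(** Removing a particle from an eigenorbital [v] lowers the energy by its level [l]. The
    coefficients of [v] enter conjugated, which is where Hermiticity of [A] and reality of [l] come
    in. *)
Lemma bilinear_op_annih_eigen A a (v : 'cV_n) (l : C) : A \is hermsymmx ->
    l \is Num.real -> A *m v = l *: v ->
  bilinear_op c A a *m \sum_i (v i 0)^* *: c i
  = (\sum_i (v i 0)^* *: c i) *m bilinear_op c A a
    - l *: \sum_i (v i 0)^* *: c i.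
Proof.
move=> /hermsymP hA lr Av; rewrite mulmx_sumr mulmx_suml.
under eq_bigr do rewrite -scalemxAr bilinear_op_annih scalerBr scalemxAl.
rewrite sumrB; congr (_ - _).
under eq_bigr do rewrite scaler_sumr.
rewrite exchange_big scaler_sumr; apply: eq_bigr => j _ /=.
under eq_bigr do rewrite scalerA.
rewrite -scaler_suml scalerA; congr (_ *: _).
have /matrixP/(_ j 0) := Av; rewrite !mxE => /(congr1 (fun x : C => x^*)).
rewrite [(l * _)^*]rmorphM /= (CrealP lr) => <-; rewrite rmorph_sum /=; apply: eq_bigr => i _.
by rewrite rmorphM /= mulrC -[in LHS]hA !mxE.
Qed.

Lemma bilinear_op_creat_eigen A a (v : 'cV_n) (l : C) : A *m v = l *: v ->
  bilinear_op c A a *m \sum_i v i 0 *: (c i)^t*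
  = (\sum_i v i 0 *: (c i)^t*) *m bilinear_op c A a
    + l *: \sum_i v i 0 *: (c i)^t*.
Proof.
move=> Av; rewrite mulmx_sumr mulmx_suml.
under eq_bigr do rewrite -scalemxAr bilinear_op_creat scalerDr scalemxAl.
rewrite big_split; congr (_ + _).
under eq_bigr do rewrite scaler_sumr.
rewrite exchange_big scaler_sumr; apply: eq_bigr => j _ /=.
under eq_bigr do rewrite scalerA.
rewrite -scaler_suml scalerA; congr (_ *: _).
have /matrixP/(_ j 0) := Av; rewrite !mxE => <-.
by apply: eq_bigr => i _; rewrite mulrC.
Qed.

Lemma anticomm_modes (v w : 'cV[C]_n) :
  (\sum_i (v i 0)^* *: c i) *m (\sum_i w i 0 *: (c i)^t*)
  + (\sum_i w i 0 *: (c i)^t*) *m (\sum_i (v i 0)^* *: c i)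
  = ((v^t* *m w) 0 0)%:M.
Proof.
rewrite mulmx_suml mulmx_sumr -big_split mxE raddf_sum; apply: eq_bigr => i _ /=.
rewrite -scalemxAl -scalemxAr -scalerDr mulmx_sumr mulmx_suml -big_split /=.
rewrite (bigD1 i) //= big1 => [|j ji]; rewrite -scalemxAl -scalemxAr -scalerDr ccd.
  by rewrite eqxx addr0 !scale_scalar_mx mulr1 !mxE.
by rewrite eq_sym (negPf ji) scale_scalar_mx mulr0 raddf0.
Qed.

End CAR.

Lemma fock_dim_gt0 : (0 < fock_dim n)%N.
Proof. by apply/card_gt0P; exists finset.set0. Qed.

Lemma scalar_fock_inj : injective (fun a => a%:M : 'M[C]_(fock_dim n)).
Proof.
move=> a b /matrixP/(_ (Ordinal fock_dim_gt0) (Ordinal fock_dim_gt0)).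
by rewrite !mxE eqxx.
Qed.

Lemma bilinear_op_sum (I : finType) (c : 'I_n -> 'M[C]_(fock_dim n))
    (h : I -> 'M[C]_n) (k : I -> C) :
  \sum_x bilinear_op c (h x) (k x) = bilinear_op c (\sum_x h x) (\sum_x k x).
Proof.
rewrite /bilinear_op big_split; congr (_ + _); last by rewrite raddf_sum.
rewrite exchange_big; apply: eq_bigr => i _; rewrite exchange_big.
by apply: eq_bigr => j _; rewrite -scaler_suml summxE.
Qed.

(** Relabelled modes obey the same anticommutation relations, so [bilinear_op_coef] reads off both
    matrices from the one operator. *)
Lemma bilinear_op_relabel (T : 'I_n -> 'I_n) (A : 'M[C]_n) (a b : C) :
    injective T ->
    bilinear_op (fun i => annih C (T i)) A a = bilinear_op (@annih C n) A b ->
  forall i j, A (T i) (T j) = A i j.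
Proof.
move=> Tinj eqT i j; apply: scalar_fock_inj => /=.
rewrite -(bilinear_op_coef (@annih_anticomm C n) (@annih_creat_anticomm C n) A b).
rewrite -eqT -(@bilinear_op_coef (fun i => annih C (T i)) _ _ A a) //.
  by move=> k l; rewrite annih_anticomm.
by move=> k l; rewrite annih_creat_anticomm (inj_eq Tinj).
Qed.

(** Bridge from column eigenvectors to the row notion: were A - e without row kernel, it would be
    invertible and force [x] to vanish. *)
Lemma col_eigenvalue p (A : 'M[C]_p) (x : 'cV_p) e :
  A *m x = e *: x -> x != 0 -> eigenvalue A e.
Proof.
move=> Ax; apply: contraR; rewrite negbK kermx_eq0 row_free_unit => Au.
rewrite -(mulKmx Au x) mulmxBl Ax mul_scalar_mx subrr mulmx0 //.
Qed.

Section GroundState.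
Variables (I : Type) (h : I -> 'M[C]_n) (a : I -> C).
Hypothesis hh : forall x, h x \is hermsymmx.
Local Notation H x := (bilinear_op (@annih C n) (h x) (a x)).

(* A positive (negative) single-particle level of a local term is empty (filled)
   in a common ground state, so the two kinds are orthogonal. *)
Lemma frustration_free_orthogonal x y (l m : C) (v w : 'cV_n) :
    frustration_free (fun x => H x) -> 0 < l -> m < 0 ->
    h x *m v = l *: v -> h y *m w = m *: w ->
  w^t* *m v = 0.
Proof.
case=> Phi Phi0 gs l0 m0 hv hw.
(* Otherwise [X *m Phi] would be an eigenvector of energy [e - d], below the minimum. *)
have low z e (X : 'M[C]_(fock_dim n)) (d : C) : min_eigenvalue (H z) e ->
    H z *m Phi = e *: Phi -> 0 < d ->
    H z *m X = X *m H z - d *: X -> X *m Phi = 0.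
  move=> [_ emin] eP d0 HX; apply/eqP/contraT => XP0.
  have : H z *m (X *m Phi) = (e - d) *: (X *m Phi).
    by rewrite mulmxA HX mulmxBl -mulmxA eP -scalemxAr -scalemxAl scalerBl.
  by move/col_eigenvalue/(_ XP0)/emin; rewrite lerBrDr gerDl => /le_gtF; rewrite d0.
have [ex minx ePx] := gs x; have [ey miny ePy] := gs y.
have vP := low _ _ _ _ minx ePx l0
  (bilinear_op_annih_eigen (@annih_anticomm C n) (@annih_creat_anticomm C n)
     (a x) (hh x) (gtr0_real l0) hv).
(* Creating a particle in the level [m < 0] would lower the energy by [- m], so this operator kills
   [Phi] as well. *)
have wP : (\sum_i w i 0 *: (annih C i)^t*) *m Phi = 0.
  apply: (low _ _ _ (- m) miny ePy); first by rewrite oppr_gt0.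
  rewrite scaleNr opprK.
  exact: (bilinear_op_creat_eigen (@annih_anticomm C n) (@annih_creat_anticomm C n)).
(* The anticommutator of the two operators is the scalar v^* w. Both operators kill the nonzero
   vector [Phi], so the scalar vanishes. *)
have := anticomm_modes (@annih_creat_anticomm C n) v w.
move/(congr1 (fun X => X *m Phi)); rewrite mulmxDl -!mulmxA vP wP !mulmx0 addr0.
rewrite mul_scalar_mx => /esym/eqP; rewrite scaler_eq0 (negPf Phi0) orbF => /eqP vw.
have vw0 : v^t* *m w = 0 by apply/matrixP => i j; rewrite !ord1 vw mxE.
by rewrite -[w^t* *m v]trmxCK adjmxM trmxCK vw0 trmx0 map_mx0.
Qed.

End GroundState.
End Fock.

(** * Trigonometric polynomials *)

Section Phases.
Variable R : realType.
Implicit Types a b : R.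

Lemma exp_mi0 : exp_mi (0 : R) = 1.
Proof. by rewrite /exp_mi cos0 sin0 oppr0. Qed.

Lemma exp_miD a b : exp_mi (a + b) = exp_mi a * exp_mi b.
Proof.
rewrite /exp_mi cosD sinD; apply/eqP; rewrite eq_complex /=.
by apply/andP; split; apply/eqP; ring.
Qed.

Lemma exp_miN a : exp_mi (- a) = (exp_mi a)^*.
Proof. by rewrite /exp_mi cosN sinN. Qed.

Lemma exp_miMn a n : exp_mi (a * n%:R) = exp_mi a ^+ n.
Proof.
elim: n => [|n IH]; first by rewrite mulr0 exp_mi0.
by rewrite -natr1 mulrDr mulr1 exp_miD IH exprSr.
Qed.

Lemma exp_mi_neq0 a : exp_mi a != 0.
Proof.
apply: contraTneq (oner_neq0 R[i]) => a0.
by rewrite -exp_mi0 -(subrr a) exp_miD a0 mul0r eqxx.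
Qed.

Lemma bounded_derivative_lipschitz (f df : R -> R) :
  (forall x : R, is_derive x (1 : R) f (df x)) -> (forall x, `|df x| <= 1) ->
  forall a b, `|f a - f b| <= `|a - b|.
Proof.
move=> fd df1 a b; wlog ab : a b / b <= a.
  move=> H; have [/H//|/ltW/H] := leP b a.
  by rewrite distrC [X in _ <= X]distrC.
have fc : {within `[b, a]%classic, continuous f}.
  apply: continuous_subspaceT => x.
  by apply/differentiable_continuous/derivable1_diffP; case: (fd x).
have [c _ ->] := MVT_segment ab (fun x _ => fd x) fc.
by rewrite normrM ler_piMl.
Qed.

(** The cosine and sine bounds make the squared modulus at most 2 |a - b|^2; the constant 2 is a
    convenient bound for the square root of 2. *)
Lemma exp_mi_lipschitz a b : `|exp_mi a - exp_mi b| <= (2 * `|a - b|)%:C%C.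
Proof.
have C := @bounded_derivative_lipschitz cos (fun x => - sin x) _ _ a b.
have S := @bounded_derivative_lipschitz sin cos _ (@cos_max R) a b.
rewrite normc_def lecR /=.
rewrite -[leRHS]ger0_norm ?mulr_ge0 // -sqrtr_sqr ler_wsqrtr //.
have {}C : `|cos a - cos b| <= `|a - b|.
  by apply: C => x; rewrite normrN sin_max.
have {}S : `|sin a - sin b| <= `|a - b| by apply: S => x.
have sq (x y : R) : `|x| <= `|y| -> x ^+ 2 <= y ^+ 2.
  move=> xy; rewrite -[x ^+ 2]real_normK ?num_real //.
  by rewrite -[y ^+ 2]real_normK ?num_real // lerXn2r ?nnegrE.
have := sq _ _ C; have := sq _ _ S; rewrite exprMn real_normK ?num_real //.
move: (sqr_ge0 (a - b)); move: ((a - b) ^+ 2) => z z0.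
have -> : (- sin a - - sin b) ^+ 2 = (sin a - sin b) ^+ 2 by ring.
move: ((cos a - cos b) ^+ 2) ((sin a - sin b) ^+ 2) => x y; lra.
Qed.

Lemma horner_circle_neq0 (p : {poly R[i]}) : p != 0 -> exists t, p.[exp_mi t] != 0.
Proof.
move=> p0; apply: contrapT => H.
have pt t : root p (exp_mi t).
  by apply/negPn/negP => pt; apply: H; exists t.
(* These angles are distinct and lie in [0, pi], where the cosine is injective. They provide
   [size p] different points of the circle, more than a nonzero polynomial has roots. *)
pose z i := exp_mi (i.+1%:R^-1 : R).
have zI : injective z.
  move=> i j [/cos_inj cij _].
  have : (i.+1%:R^-1 : R) = j.+1%:R^-1.
    have ub (m : nat) : (m.+1%:R^-1 : R) \in `[0, pi].
      rewrite in_itv /= invr_ge0 ler0n /= (le_trans _ (@pi_ge2 R)) //.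
      rewrite (le_trans _ (_ : 1 <= 2)) ?ler1n // invf_le1 ?ltr0n // ler1n //.
    by apply: cij; apply: ub.
  by move/invr_inj/eqP; rewrite eqr_nat => /eqP[].
have := @max_poly_roots _ p (map z (iota 0 (size p))) p0.
rewrite size_map size_iota ltnn map_inj_uniq // iota_uniq.
move=> H'; suff /H'/(_ isT) : all (root p) [seq z i | i <- iota 0 (size p)] by [].
by apply/allP => x /mapP[i _ ->]; apply: pt.
Qed.

End Phases.

Section TrigPoly.
Variables (R : realType) (d : nat).
Implicit Types (k : 'rV[R]_d) (f g : 'rV[R]_d -> R[i]) (t : R).

Definition set_coord k (j : 'I_d) t : 'rV[R]_d := \row_i if i == j then t else k 0 i.

(* Along each coordinate line, f is a Laurent polynomial in z = e^{-i t}. *)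
Definition trigpoly f := forall k j, exists m (p : {poly R[i]}), forall t,
  f (set_coord k j t) * exp_mi t ^+ m = p.[exp_mi t].

Lemma eq_trigpoly f g : f =1 g -> trigpoly f -> trigpoly g.
Proof.
move=> fg tf k j; have [m [p H]] := tf k j.
by exists m, p => t; rewrite -fg.
Qed.

Lemma trigpoly_const c : trigpoly (fun=> c).
Proof. by move=> k j; exists 0, c%:P => t; rewrite hornerC mulr1. Qed.

Lemma trigpolyD f g : trigpoly f -> trigpoly g -> trigpoly (fun k => f k + g k).
Proof.
move=> tf tg k j; have [m [p Hp]] := tf k j; have [m' [q Hq]] := tg k j.
exists (m + m')%N, (p * 'X^m' + q * 'X^m) => t.
by rewrite !hornerE -Hp -Hq exprD; ring.
Qed.

Lemma trigpolyM f g : trigpoly f -> trigpoly g -> trigpoly (fun k => f k * g k).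
Proof.
move=> tf tg k j; have [m [p Hp]] := tf k j; have [m' [q Hq]] := tg k j.
by exists (m + m')%N, (p * q) => t; rewrite !hornerE -Hp -Hq exprD; ring.
Qed.

Lemma trigpoly_sum (I : Type) (r : seq I) (P : pred I) (F : I -> 'rV[R]_d -> R[i]) :
  (forall i, trigpoly (F i)) -> trigpoly (fun k => \sum_(i <- r | P i) F i k).
Proof.
move=> tF; elim: r => [|i r IH].
  by apply: eq_trigpoly (trigpoly_const 0) => k; rewrite big_nil.
apply: eq_trigpoly (fun k => _) _; last first.
  exact: trigpolyD (trigpolyM (trigpoly_const (P i)%:R) (tF i)) IH.
by move=> k /=; rewrite big_cons; case: (P i); rewrite ?mul1r // mul0r add0r.
Qed.

Lemma trigpoly_prod (I : Type) (r : seq I) (P : pred I) (F : I -> 'rV[R]_d -> R[i]) :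
  (forall i, trigpoly (F i)) -> trigpoly (fun k => \prod_(i <- r | P i) F i k).
Proof.
move=> tF; elim: r => [|i r IH].
  by apply: eq_trigpoly (trigpoly_const 1) => k; rewrite big_nil.
case Pi: (P i); last first.
  by apply: eq_trigpoly IH => k; rewrite big_cons Pi.
by apply: eq_trigpoly (trigpolyM (tF i) IH) => k; rewrite big_cons Pi.
Qed.

Lemma trigpoly_exp (n : 'I_d -> int) :
  trigpoly (fun k => exp_mi (\sum_(j < d) k 0 j * (n j)%:~R)).
Proof.
move=> k j.
pose c := exp_mi (\sum_(i < d | i != j) k 0 i * (n i)%:~R).
have split t : exp_mi (\sum_(i < d) set_coord k j t 0 i * (n i)%:~R)
    = exp_mi (t * (n j)%:~R) * c.
  rewrite (bigD1 j) //= exp_miD mxE eqxx; congr (_ * exp_mi _).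
  by apply: eq_bigr => i ij; rewrite mxE (negPf ij).
(* A nonnegative exponent gives a monomial in z; a negative one is cleared by the power [a.+1] of
   z. *)
case nj: (n j) => [a|a].
  exists 0, (c *: 'X^a) => t.
  by rewrite split nj mulr1 !hornerE /= exp_miMn mulrC.
exists a.+1, c%:P => t; rewrite split nj NegzE hornerC.
by rewrite mulrAC mulrNz mulrN -pmulrn -exp_miMn -exp_miD addNr exp_mi0 mul1r.
Qed.

Lemma trigpoly_det n (M : 'rV[R]_d -> 'M[R[i]]_n) :
  (forall i j, trigpoly (fun k => M k i j)) -> trigpoly (fun k => \det (M k)).
Proof.
move=> tM; apply: trigpoly_sum => s; apply: trigpolyM; first exact: trigpoly_const.
exact: trigpoly_prod.
Qed.

Lemma trigpoly_mulmx m n p (A : 'rV[R]_d -> 'M[R[i]]_(m, n))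
    (B : 'rV[R]_d -> 'M[R[i]]_(n, p)) :
  (forall i j, trigpoly (fun k => A k i j)) ->
  (forall i j, trigpoly (fun k => B k i j)) ->
  forall i j, trigpoly (fun k => (A k *m B k) i j).
Proof.
move=> tA tB i j; apply: (@eq_trigpoly (fun k => \sum_l A k i l * B k l j)).
  by move=> k; rewrite mxE.
by apply: trigpoly_sum => l; apply: trigpolyM.
Qed.

(* The two momenta are made to agree one coordinate at a time; along each
   coordinate both functions are nonzero polynomials in z = e^{-i t}. *)
Lemma trigpoly_common_neq0 f g k1 k2 : trigpoly f -> trigpoly g ->
  f k1 != 0 -> g k2 != 0 -> exists k, f k != 0 /\ g k != 0.
Proof.
move=> tf tg fk gk.
have step m : (m <= d)%N -> exists k1 k2, [/\ f k1 != 0, g k2 != 0 &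
    forall j : 'I_d, (j < m)%N -> k1 0 j = k2 0 j].
  elim: m => [|m IH] md; first by exists k1, k2.
  have [l1 [l2 [fl gl l12]]] := IH (ltnW md); pose j := Ordinal md.
  have [m1 [p Hp]] := tf l1 j; have [m2 [q Hq]] := tg l2 j.
  have setid l : set_coord l j (l 0 j) = l.
    by apply/rowP => i; rewrite mxE; case: eqP => [->|].
  have p0 : p != 0.
    apply: contraNneq fl => p0; have := Hp (l1 0 j).
    rewrite setid p0 horner0 => /eqP.
    by rewrite mulf_eq0 expf_eq0 (negPf (exp_mi_neq0 _)) andbF orbF.
  have q0 : q != 0.
    apply: contraNneq gl => q0; have := Hq (l2 0 j).
    rewrite setid q0 horner0 => /eqP.
    by rewrite mulf_eq0 expf_eq0 (negPf (exp_mi_neq0 _)) andbF orbF.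
  have [t] := horner_circle_neq0 (mulf_neq0 p0 q0).
  rewrite hornerM mulf_eq0 -Hp -Hq !mulf_eq0 !negb_or => /andP[/andP[ft _] /andP[gt _]].
  exists (set_coord l1 j t), (set_coord l2 j t); split=> // i im.
  rewrite !mxE; case: eqVneq => // ij; apply: l12.
  by rewrite ltn_neqAle -ltnS im andbT.
have [l1 [l2 [fl gl l12]]] := step d (leqnn d).
exists l1; split=> //; suff -> : l1 = l2 by [].
by apply/rowP => j; apply: l12.
Qed.

(** Gaussian elimination with the outer factors truncated to size [p]. A lower bound on the rank
    becomes the nonvanishing of one determinant. *)
Lemma rank_submatrix n (A : 'M[R[i]]_n) p : (p <= \rank A)%N ->
  exists U : 'M[R[i]]_(p, n), exists V : 'M[R[i]]_(n, p), U *m A *m V = 1%:M.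
Proof.
move=> pA; exists (pid_mx p *m invmx (col_ebase A)), (invmx (row_ebase A) *m pid_mx p).
rewrite -{2}(mulmx_ebase A) !mulmxA mulmxKV ?col_ebase_unit //.
rewrite -!mulmxA [row_ebase A *m _]mulmxA mulmxV ?row_ebase_unit // mul1mx.
rewrite !mul_pid_mx (minn_idPr pA) (minn_idPr (leq_trans pA (rank_leq_row A))).
by rewrite minnn (minn_idPr (leq_trans pA (rank_leq_row A))) pid_mx_1.
Qed.

Lemma det_neq0_rank n (A : 'M[R[i]]_n) p (U : 'M[R[i]]_(p, n)) (V : 'M[R[i]]_(n, p)) :
  \det (U *m A *m V) != 0 -> (p <= \rank A)%N.
Proof.
rewrite -unitfE -unitmxE -row_free_unit /row_free => /eqP <-.
by apply: leq_trans (mxrankM_maxl _ _) (mxrankM_maxr _ _).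
Qed.

(** The outer factors are fixed at [k1] and [k2]. The two determinants they define are trigonometric
    polynomials in the momentum, hence nonzero together at some [k], which bounds both ranks there
    from below. *)
Lemma rank_common n (A B : 'rV[R]_d -> 'M[R[i]]_n) k1 k2 :
  (forall i j, trigpoly (fun k => A k i j)) ->
  (forall i j, trigpoly (fun k => B k i j)) ->
  exists k, (\rank (A k1) <= \rank (A k))%N /\ (\rank (B k2) <= \rank (B k))%N.
Proof.
move=> tA tB; have [U [V UAV]] := rank_submatrix (leqnn (\rank (A k1))).
have [U' [V' UBV]] := rank_submatrix (leqnn (\rank (B k2))).
have tpc m p (X : 'M[R[i]]_(m, p)) i j : trigpoly (fun=> X i j).
  exact: trigpoly_const.
have [] := @trigpoly_common_neq0 (fun k => \det (U *m A k *m V))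
   (fun k => \det (U' *m B k *m V')) k1 k2.
- by apply: trigpoly_det; do 2![apply: trigpoly_mulmx => //].
- by apply: trigpoly_det; do 2![apply: trigpoly_mulmx => //].
- by rewrite UAV det1 oner_neq0.
- by rewrite UBV det1 oner_neq0.
by move=> k [/det_neq0_rank Ak /det_neq0_rank Bk]; exists k.
Qed.

End TrigPoly.

(** * Families of Gram matrices over momentum space *)

(** Otherwise [S] would contain a nonzero vector of the row space of [gram F]. There [gram G]
    vanishes and [gram F] is positive definite, so the form would be positive. *)
Lemma gram_split_rank (C : numClosedFieldType) (I : finType) n p
    (F G : I -> 'M[C]_(n, p)) m (S : 'M[C]_(m, n)) :
  (forall x y, (G x)^t* *m F y = 0) ->
  (forall u : 'rV_n, (u <= S)%MS ->
     (u *m (gram F - gram G) *m u^t*) 0 0 <= 0) ->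
  (\rank S <= \rank (kermx (gram F)))%N.
Proof.
move=> GF neg; rewrite mxrank_ker leqNgt; apply/negP => ltS.
have [u u0 /andP[uS /submxP[w uA]]] :
    exists2 u : 'rV_n, u != 0 & (u <= S)%MS && (u <= gram F)%MS.
  apply: rank_cap_gt0; move: ltS (rank_leq_row (gram F)).
  by move: (\rank _) (\rank _) => a b; lia.
have uB : u *m gram G = 0.
  rewrite uA -mulmxA -[gram F *m gram G]trmxCK adjmxM !gram_adj.
  by rewrite gram_mul0 // trmx0 map_mx0 mulmx0.
have uF0 : \sum_x sqnorm (u *m F x) = 0.
  apply/eqP; rewrite eq_le sumr_ge0 => [|x _]; last exact: sqnorm_ge0.
  by rewrite andbT -quad_gram_sum -[gram F](subrK (gram G)) mulmxDr uB addr0 neg.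
have uF x : u *m F x = 0.
  move/eqP: uF0; rewrite psumr_eq0 => [/allP/(_ x)|y _]; last exact: sqnorm_ge0.
  by rewrite mem_index_enum sqnorm_eq0 => /(_ isT)/eqP.
have uA0 : u *m gram F = 0.
  by rewrite mulmx_sumr big1 // => x _; rewrite mulmxA uF mul0mx.
case/eqP: u0; apply/eqP; rewrite -sqnorm_eq0 -mxtrace_mul_adj.
by rewrite [in u^t*]uA adjmxM gram_adj mulmxA uA0 mul0mx mxtrace0.
Qed.

Section Bands.
Variables (R : realType) (d n p : nat) (I : finType).
Implicit Types (F G : 'rV[R]_d -> I -> 'M[R[i]]_(n, p)) (k : 'rV[R]_d).

Definition lipschitz_family F := exists c : R, forall k k' x i j,
  `|(F k x - F k' x) i j| <= (c * `|k - k'|)%:C%C.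

(** Conjugates are included because the entries of a Gram matrix are built from both. *)
Definition trigpoly_family F := forall x i j,
  trigpoly (fun k => F k x i j) /\ trigpoly (fun k => (F k x i j)^*).

Lemma trigpoly_gram F : trigpoly_family F ->
  forall i j, trigpoly (fun k => gram (F k) i j).
Proof.
move=> tF i j.
apply: (@eq_trigpoly _ _ (fun k => \sum_x (F k x *m (F k x)^t*) i j)).
  by move=> k; rewrite summxE.
apply: trigpoly_sum => x; apply: trigpoly_mulmx => l m; first by case: (tF x l m).
apply: (@eq_trigpoly _ _ (fun k => (F k x m l)^*)); first by move=> k; rewrite !mxE.
by case: (tF x m l).
Qed.

(** On a vector killed by every [F k0 x], the [F]-energy at [k] comes from the differences
    [F k x - F k0 x], and the [G]-part only lowers the energy. [M] is uniform in the momenta and the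
    subspaces. *)
Lemma quadratic_touching F G : lipschitz_family F ->
  (forall k x y, (G k x)^t* *m F k y = 0) ->
  exists2 M : R, 0 <= M & forall k k0 (e : R) (S T : 'M[R[i]]_n),
    (forall u : 'rV_n, (u <= S)%MS ->
      (u *m (gram (F k0) - gram (G k0)) *m u^t*) 0 0 <= 0) ->
    (forall u : 'rV_n, (u <= T)%MS ->
      e%:C%C * sqnorm u <= (u *m (gram (F k) - gram (G k)) *m u^t*) 0 0) ->
    (n < \rank S + \rank T)%N ->
    e <= M * `|k - k0| ^+ 2.
Proof.
move=> [c lipF] GF.
exists (#|I|%:R * (p%:R * (n%:R * c) ^+ 2)).
  by rewrite mulr_ge0 ?ler0n // mulr_ge0 ?ler0n // sqr_ge0.
move=> k k0 e S T negS leT nST.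
(* This lets the kernel of [gram (F k0)] replace [S] in the dimension count against [T]. *)
have rS := gram_split_rank (GF k0) negS.
have [u u0 /andP[/sub_kermxP uA uT]] : exists2 u : 'rV[R[i]]_n, u != 0 &
    (u <= kermx (gram (F k0)))%MS && (u <= T)%MS.
  by apply: rank_cap_gt0; apply: leq_trans nST _; rewrite leq_add2r.
have su : 0 < sqnorm u by rewrite lt_def sqnorm_eq0 u0 sqnorm_ge0.
rewrite -lecR -(ler_pM2r su); apply: le_trans (leT _ uT) _.
rewrite quadB (quad_gram_sum (F k)) (quad_gram_sum (G k)).
apply: (@le_trans _ _ (\sum_x sqnorm (u *m F k x))).
  by rewrite gerBl sumr_ge0 // => x _; apply: sqnorm_ge0.
pose b : R[i] := p%:R * (n%:R * c%:C%C) ^+ 2 * (`|k - k0|%:C%C) ^+ 2 * sqnorm u.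
apply: (@le_trans _ _ (\sum_(x : I) b)).
  apply: ler_sum => x _.
  have -> : u *m F k x = u *m (F k x - F k0 x).
    by rewrite mulmxBr (mulmx_gram_eq0 x uA) subr0.
  by apply: sqnorm_mul_le => i j; apply: le_trans (lipF _ _ _ _ _) _; rewrite rmorphM.
rewrite sumr_const /b le_eqVlt; apply/orP; left; apply/eqP.
by rewrite -[LHS]mulr_natl !expr2 !rmorphM /= !rmorph_nat; ring.
Qed.

(** If the band is positive at [k1] and negative at [k2], the [F]-part has rank at least n - j at
    [k1] and the [G]-part rank at least j + 1 at [k2]. At a common momentum with both ranks, the
    vanishing product of the two parts limits their sum to n, a contradiction. *)
Lemma one_signed_band F G (E : 'rV[R]_d -> 'I_n -> R) j :
  trigpoly_family F -> trigpoly_family G ->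
  (forall k x y, (G k x)^t* *m F k y = 0) ->
  (forall k, ordered_spectrum (gram (F k) - gram (G k)) (E k)) ->
  (forall k, 0 <= E k j) \/ (forall k, E k j <= 0).
Proof.
move=> tF tG GF spE.
have herm k : gram (F k) - gram (G k) \is hermsymmx.
  by apply/hermsymP; rewrite adjmxB !gram_adj.
apply: contrapT => /not_orP[/existsNP[k2 /negP] + /existsNP[k1 /negP]].
rewrite -!ltNge => E2 E1.
have [T [rT leT]] := high_energy_space j (herm k1) (spE k1).
have [S [rS leS]] := low_energy_space j (herm k2) (spE k2).
have pos (u : 'rV[R[i]]_n) : u != 0 -> 0 < sqnorm u.
  by move=> u0; rewrite lt_def sqnorm_eq0 u0 sqnorm_ge0.
have gram_ge0 (K : I -> 'M[R[i]]_(n, p)) (u : 'rV_n) : 0 <= (u *m gram K *m u^t*) 0 0.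
  by rewrite quad_gram_sum sumr_ge0 // => x _; apply: sqnorm_ge0.
have rA : (\rank T <= \rank (gram (F k1)))%N.
  apply: pos_form_rank => u uT u0; apply/eqP => uA.
  have le0 : (E k1 j)%:C%C * sqnorm u <= 0.
    apply: le_trans (leT u uT) _.
    by rewrite mulmxBr uA sub0r mulNmx mxE oppr_le0 gram_ge0.
  by move/le_gtF: le0; rewrite mulr_gt0 ?pos // ltcR.
have rB : (\rank S <= \rank (gram (G k2)))%N.
  apply: pos_form_rank => u uS u0; apply/eqP => uB.
  have le0 : 0 <= (E k2 j)%:C%C * sqnorm u.
    apply: le_trans (leS u uS); rewrite mulmxBr uB subr0; exact: gram_ge0.
  by move/le_gtF: le0; rewrite nmulr_rlt0 ?pos // ltcR.
have [k [rAk rBk]] := rank_common k1 k2 (trigpoly_gram tF) (trigpoly_gram tG).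
have := mulmx0_rank_max (gram_mul0 (GF k)).
move: (leq_trans rA rAk) (leq_trans rB rBk); rewrite rT rS.
by move: (\rank _) (\rank _) (ltn_ord j) => a b; lia.
Qed.

Lemma quadratic_band F G (E : 'rV[R]_d -> 'I_n -> R) j k0 :
  lipschitz_family F -> lipschitz_family G ->
  (forall k x y, (G k x)^t* *m F k y = 0) ->
  (forall k, ordered_spectrum (gram (F k) - gram (G k)) (E k)) ->
  E k0 j = 0 -> exists M : R, forall k, `|E k j| <= M * `|k - k0| ^+ 2.
Proof.
move=> lF lG GF spE E0.
have herm k : gram (F k) - gram (G k) \is hermsymmx.
  by apply/hermsymP; rewrite adjmxB !gram_adj.
have FG k x y : (F k x)^t* *m G k y = 0.
  by rewrite -[F k x ^t* *m _]trmxCK adjmxM trmxCK GF trmx0 map_mx0.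
have [M M0 HM] := quadratic_touching lF GF.
have [M' M'0 HM'] := quadratic_touching lG FG.
have [S [rS leS]] := low_energy_space j (herm k0) (spE k0).
have [T [rT leT]] := high_energy_space j (herm k0) (spE k0).
have rk : (n < j.+1 + (n - j))%N by move: (ltn_ord j); lia.
have opp k (u : 'rV[R[i]]_n) : (u *m (gram (G k) - gram (F k)) *m u^t*) 0 0 =
    - (u *m (gram (F k) - gram (G k)) *m u^t*) 0 0.
  by rewrite -opprB mulmxN mulNmx mxE.
exists (M + M') => k; rewrite mulrDl ler_norml; apply/andP; split.
  have [S' [rS' leS']] := low_energy_space j (herm k) (spE k).
  rewrite lerNl.
  apply: le_trans (_ : M' * `|k - k0| ^+ 2 <= _); last first.
    by rewrite lerDr mulr_ge0 // exprn_ge0.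
  (* The lower bound is the upper bound for the negated matrix: [F] and [G] are exchanged, and so
     are the high-energy and low-energy spaces. *)
  apply: (HM' k k0 _ T S'); rewrite ?rT ?rS' 1?addnC //.
    move=> u uT; rewrite opp oppr_le0.
    by have := leT u uT; rewrite E0 rmorph0 mul0r.
  by move=> u uS'; rewrite opp rmorphN mulNr lerN2; exact: leS'.
have [T' [rT' leT']] := high_energy_space j (herm k) (spE k).
apply: le_trans (_ : M * `|k - k0| ^+ 2 <= _); last first.
  by rewrite lerDl mulr_ge0 // exprn_ge0.
apply: (HM k k0 _ S T'); rewrite ?rS ?rT' //.
by move=> u /leS; rewrite E0 rmorph0 mul0r.
Qed.
End Bands.

(** * Bloch waves on the torus *)

Section CentredLift.
Variable L : nat.
Hypothesis L_gt1 : (1 < L)%N.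
Implicit Types (u v : 'Z_L) (z : int).

(** The representative in (-L/2, L/2], whose absolute value is the distance to 0 on the cycle. *)
Definition centred u : int := if (u.*2 <= L)%N then u%:Z else u%:Z - L%:Z.

Lemma ltn_Zp u : (u < L)%N.
Proof. by have := ltn_ord u; rewrite [X in (_ < X)%N]Zp_cast. Qed.

Lemma centred_cast u : (centred u)%:~R = u.
Proof.
rewrite /centred; case: ifP => _; rewrite ?rmorphB /= -?pmulrn natr_Zp //.
by rewrite pchar_Zp // subr0.
Qed.

Lemma abs_centred u : `|centred u|%N = minn u (L - u).
Proof. by rewrite /centred; have := ltn_Zp u; case: ifP; lia. Qed.

Lemma cast_centred z : (`|z|.*2 < L)%N -> centred z%:~R = z.
Proof.
case: z => [m|m] /= mL.
  rewrite /centred -pmulrn val_Zp_nat // modn_small; last by lia.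
  by case: ifP => //; lia.
have vE : (Negz m)%:~R = (L - m.+1)%:R :> 'Z_L.
  by rewrite NegzE mulrNz -pmulrn natrB ?pchar_Zp ?sub0r //; lia.
rewrite /centred vE val_Zp_nat // modn_small; last by lia.
by case: ifP; lia.
Qed.

(** The integer difference is at most 2s in absolute value, less than L/2, so no wrap-around
    occurs. *)
Lemma centred_sub s u v : (4 * s < L)%N -> (`|centred u| <= s)%N ->
  (`|centred v| <= s)%N -> centred (u - v) = centred u - centred v.
Proof.
move=> sL us vs; rewrite -{1}(centred_cast u) -{1}(centred_cast v) -rmorphB /= cast_centred //.
by move: us vs; move: (centred u) (centred v) => a b; lia.
Qed.

End CentredLift.

Section Phase.
Variables (R : realType) (L d : nat).
Hypothesis L_gt1 : (1 < L)%N.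
Implicit Types (x y u v : lattice L d) (k : 'rV[R]_d).

Lemma torus_normP s x :
  reflect (forall j, (`|centred (x 0%R j)| <= s)%N) (torus_norm x <= s)%N.
Proof.
apply: (iffP (bigmax_leqP _ _ _)) => H j; last by move=> _; rewrite -abs_centred.
by rewrite abs_centred //; apply: H.
Qed.

(** For general real [k] the plane wave is not periodic on the torus, so its value depends on the
    chosen representative; [phase_sub] gives multiplicativity for short displacements. *)
Definition phase k x : R[i] := exp_mi (\sum_(j < d) k 0 j * (centred (x 0 j))%:~R).

Lemma torus_norm_sub s x y : (4 * s < L)%N ->
  (torus_norm x <= s)%N -> (torus_norm y <= s)%N ->
  (torus_norm (x - y)%R <= 2 * s)%N.
Proof.
move=> sL /torus_normP xs /torus_normP ys; apply/torus_normP => j.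
rewrite !mxE (centred_sub L_gt1 sL (xs j) (ys j)).
by move: (xs j) (ys j); move: (centred _) (centred _) => a b; lia.
Qed.

Lemma phase_sub s k x y : (4 * s < L)%N ->
  (torus_norm x <= s)%N -> (torus_norm y <= s)%N ->
  phase k (x - y) = phase k x * (phase k y)^*.
Proof.
move=> sL /torus_normP xs /torus_normP ys.
rewrite /phase -exp_miN -exp_miD; congr exp_mi.
rewrite -sumrB; apply: eq_bigr => j _; rewrite -mulrBr -rmorphB /=.
by rewrite !mxE (centred_sub L_gt1 sL (xs j) (ys j)).
Qed.

(** The constant collects 2 from [exp_mi_lipschitz], the number d of coordinates, and the bound L on
    each centred coordinate. *)
Lemma phase_lipschitz k k' x :
  `|phase k x - phase k' x| <= ((2 * d * L)%:R * `|k - k'|)%:C%C.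
Proof.
apply: le_trans (exp_mi_lipschitz _ _) _; rewrite lecR.
rewrite -sumrB -mulnA natrM -mulrA ler_wpM2l //.
apply: le_trans (ler_norm_sum _ _ _) _.
apply: le_trans (_ : \sum_(j < d) L%:R * `|k - k'| <= _); last first.
  by rewrite sumr_const card_ord natrM -mulrA -[leLHS]mulr_natl.
apply: ler_sum => j _; rewrite -mulrBl normrM mulrC ler_pM //.
  rewrite -intr_norm.
  rewrite -abszE -pmulrn ler_nat.
  by rewrite abs_centred //; have := ltn_Zp L_gt1 (x 0 j); lia.
rewrite {2}/Num.norm /= mx_normrE.
have := le_bigmax 0 (fun ij => `|(k - k') ij.1 ij.2|) (0, j).
by rewrite /= !mxE.
Qed.

Lemma phase_displacement s k (delta : {ffun 'I_d -> 'I_(4 * s).+1}) :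
  (4 * s < L)%N ->
  phase k (\row_j (displacement delta j)%:~R)
  = exp_mi (\sum_(j < d) k 0 j * (displacement delta j)%:~R).
Proof.
move=> sL; congr exp_mi; apply: eq_bigr => j _; rewrite mxE cast_centred //.
by rewrite /displacement; have := ltn_ord (delta j); lia.
Qed.

(** As 4s < L, the vectors of {-2s, ..., 2s}^d are distinct modulo L and represent exactly the sites
    of norm at most 2s. *)
Lemma sum_displacement s (f : lattice L d -> R[i]) : (4 * s < L)%N ->
  (forall x, (2 * s < torus_norm x)%N -> f x = 0) ->
  \sum_(delta : {ffun 'I_d -> 'I_(4 * s).+1}) f (\row_j (displacement delta j)%:~R)
  = \sum_x f x.
Proof.
move=> sL f0; rewrite [RHS](bigID (fun x => torus_norm x <= 2 * s)%N) /=.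
rewrite [X in _ + X]big1 ?addr0; last by move=> x; rewrite -ltnNge => /f0.
(* The shift by 2s moves centred coordinates from [-2s, 2s] to indices in [0, 4s]. *)
pose lift (x : lattice L d) : {ffun 'I_d -> 'I_(4 * s).+1} :=
  [ffun j => inord (absz (centred (x 0 j) + (2 * s)%:Z))].
have dE (delta : {ffun 'I_d -> 'I_(4 * s).+1}) j :
    centred ((displacement delta j)%:~R : 'Z_L) = displacement delta j.
  rewrite cast_centred //.
  by rewrite /displacement; have := ltn_ord (delta j); lia.
rewrite (reindex_onto (fun delta => \row_j (displacement delta j)%:~R) lift).
  apply: eq_bigl => delta; apply/esym/andP; split.
    apply/torus_normP => j; rewrite mxE dE /displacement.
    by have := ltn_ord (delta j); lia.
  apply/eqP/ffunP => j; rewrite ffunE mxE dE /displacement; apply: val_inj => /=.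
  by rewrite subrK /= inord_val.
move=> x /torus_normP xs; apply/rowP => j; rewrite !mxE /displacement ffunE.
rewrite -[RHS](centred_cast L_gt1); congr (_%:~R).
by move: (xs j); move: (centred _) => a aj; rewrite inordK; lia.
Qed.

End Phase.

(** * Fourier transform of the local terms *)

Section Modes.
Variables (R : realType) (L d N : nat).
Hypothesis L_gt1 : (1 < L)%N.
Implicit Types (x y z a : lattice L d) (k : 'rV[R]_d) (t : 'I_N).
Local Notation n := (nmodes L d N).

Lemma sum_modes (f : 'I_n -> R[i]) :
  \sum_i f i = \sum_z \sum_t f (mode z t).
Proof.
rewrite pair_big /= (reindex (@enum_rank (modes L d N))) /=.
  by apply: eq_bigr => -[z t] _.
by exists enum_val => x _; rewrite ?enum_rankK ?enum_valK.
Qed.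

Lemma modeE i : i = mode (enum_val i).1 (enum_val i).2 :> 'I_n.
Proof. by rewrite /mode -surjective_pairing enum_valK. Qed.

Lemma translate_mode_mode a z t : translate_mode a (mode z t) = mode (z + a) t.
Proof. by rewrite /translate_mode enum_rankK. Qed.

Lemma translate_mode_inj a : injective (@translate_mode L d N a).
Proof.
apply: (can_inj (g := @translate_mode L d N (- a))) => i.
by rewrite [in LHS](modeE i) !translate_mode_mode addrK -modeE.
Qed.

(* Plane waves whose phases are measured from the centre x of a local term; this
   makes them single-valued on the support of the term for every real k. *)
Definition fourier k x : 'M[R[i]]_(N, n) := \matrix_(t, i)
  if (enum_val i).2 == t then phase k ((enum_val i).1 - x) else 0.

Lemma fourier_mode k x t z s :
  fourier k x t (mode z s) = if s == t then phase k (z - x) else 0.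
Proof. by rewrite mxE enum_rankK. Qed.

Lemma mul_fourier k x p (A : 'M[R[i]]_(n, p)) t j :
  (fourier k x *m A) t j = \sum_z phase k (z - x) * A (mode z t) j.
Proof.
rewrite mxE sum_modes; apply: eq_bigr => z _.
rewrite (bigD1 t) //= fourier_mode eqxx big1 ?addr0 // => s st.
by rewrite fourier_mode (negPf st) mul0r.
Qed.

Lemma mul_fourier_adj k x p (A : 'M[R[i]]_(p, n)) j t :
  (A *m (fourier k x)^t*) j t = \sum_z A j (mode z t) * (phase k (z - x))^*.
Proof.
rewrite mxE sum_modes; apply: eq_bigr => z _.
rewrite (bigD1 t) //= 2!mxE fourier_mode eqxx big1 ?addr0 // => s st.
by rewrite 2!mxE fourier_mode (negPf st) rmorph0 mulr0.
Qed.

Section Bloch.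
Variables (r : nat) (h : lattice L d -> 'M[R[i]]_n).
Hypothesis rL : (4 * r < L)%N.
Hypothesis hr : forall x, has_range r x (h x).
Hypothesis hT : forall a i j,
  (\sum_x h x) (translate_mode a i) (translate_mode a j) = (\sum_x h x) i j.

(** By translation invariance the hopping can be read at any reference site, so it is summed over
    all of them. Once the total is split into the [h x], only sites near [x] contribute, and there
    the phase factorises around [x]. *)
Lemma bloch_average k : #|{: lattice L d}|%:R *: bloch h r k =
  \sum_x fourier k x *m h x *m (fourier k x)^t*.
Proof.
apply/matrixP => t t'; rewrite mxE summxE.
have -> : bloch h r k t t' = \sum_x phase k x * hopping h x t t'.
  rewrite mxE -(@sum_displacement _ _ _ L_gt1 r) //.
    by apply: eq_bigr => delta _; rewrite phase_displacement.
  move=> x; rewrite ltnNge => xr; rewrite /hopping summxE big1 ?mulr0 // => y _.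
  apply: hr; rewrite !ltnNge -negb_and.
  apply: contra xr => /andP[xy y0].
  (* If [x] and the origin both lie within r of the centre [y], their difference has norm at most
     2r. *)
  have -> : x = (x - y) - (0 - y) by rewrite opprB subr0 subrK.
  exact: torus_norm_sub.
transitivity (\sum_y \sum_z phase k (z - y) * (\sum_x h x) (mode z t) (mode y t')).
  rewrite mulr_natl -sumr_const; apply: eq_bigr => y _.
  rewrite [RHS](reindex_inj (addIr y)); apply: eq_bigr => x _ /=.
  by rewrite addrK /hopping -(hT y) !translate_mode_mode add0r.
transitivity (\sum_y \sum_z \sum_x phase k (z - y) * h x (mode z t) (mode y t')).
  by apply: eq_bigr => y _; apply: eq_bigr => z _; rewrite summxE mulr_sumr.
under eq_bigr do rewrite exchange_big.
rewrite exchange_big; apply: eq_bigr => x _ /=.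
rewrite mul_fourier_adj; apply: eq_bigr => y _.
rewrite mul_fourier mulr_suml; apply: eq_bigr => z _.
have [/andP[zx yx]|] := boolP ((torus_norm (z - x)%R <= r) && (torus_norm (y - x)%R <= r))%N.
  rewrite mulrAC -(phase_sub _ _ rL) //; congr (phase _ _ * _).
  by rewrite opprB addrA subrK.
by rewrite negb_and -!ltnNge => /hr ->; rewrite !(mulr0, mul0r).
Qed.

End Bloch.

Section Orthogonality.
Variables (r p : nat) (F G : lattice L d -> 'M[R[i]]_(n, p)).
Hypothesis rL : (4 * r < L)%N.
Hypothesis Fr : forall x z t, (r < torus_norm (z - x)%R)%N -> row (mode z t) (F x) = 0.
Hypothesis Gr : forall x z t, (r < torus_norm (z - x)%R)%N -> row (mode z t) (G x) = 0.
Hypothesis GF : forall a x y,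
  (\matrix_(i, j) G x (translate_mode a i) j)^t* *m F y = 0.

(* Grouping the double sum over sites by the displacement a = z - u turns it into
   a combination of the products (T_a G)^* F. *)
Lemma fourier_orthogonal k x y :
  (fourier k y *m G y)^t* *m (fourier k x *m F x) = 0.
Proof.
apply/matrixP => i j; rewrite [RHS]mxE mxE.
pose term a u t := phase k (y - x - a) *
  ((G y (mode (u + a) t) i)^* * F x (mode u t) j).
transitivity (\sum_t \sum_u \sum_a term a u t).
  apply: eq_bigr => t _; rewrite 2!mxE !mul_fourier mulr_sumr.
  apply: eq_bigr => u _; rewrite rmorph_sum mulr_suml.
  rewrite (reindex_inj (addrI u)); apply: eq_bigr => a _ /=.
  rewrite /term.
  have [ux|ux] := leqP (torus_norm (u - x)%R) r; last first.
    by have /rowP/(_ j) := Fr t ux; rewrite !mxE => ->; rewrite !mulr0.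
  have [uy|uy] := leqP (torus_norm (u + a - y)%R) r; last first.
    have /rowP/(_ i) := Gr t uy; rewrite !mxE => ->.
    by rewrite rmorphM !rmorph0 mulr0 !mul0r mulr0.
  (* The phase of [y - x - a] is free of [u], so it can leave the sum over [u]; within range it
     splits into the phases of the two plane waves. *)
  have -> : y - x - a = (u - x) - (u + a - y).
    by apply/rowP => l; rewrite !mxE; ring.
  by rewrite (phase_sub L_gt1 k rL ux uy) rmorphM /=; ring.
under eq_bigr do rewrite exchange_big.
rewrite exchange_big big1 //= => a _.
rewrite exchange_big /=.
have /matrixP/(_ i j) := GF a y x; rewrite [RHS]mxE mxE sum_modes => GFa.
under eq_bigr do under eq_bigr do rewrite /term.
under eq_bigr do rewrite -mulr_sumr.
rewrite -mulr_sumr [X in _ * X](_ : _ = 0) ?mulr0 // -[RHS]GFa.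
apply: eq_bigr => u _; apply: eq_bigr => t _.
by rewrite !mxE translate_mode_mode.
Qed.

End Orthogonality.

Lemma trigpoly_fourier p (F : lattice L d -> 'M[R[i]]_(n, p)) (c : R[i]) :
  trigpoly_family (fun k x => c *: (fourier k x *m F x)).
Proof.
move=> x t j.
have ph z : trigpoly (fun k => phase k z).
  exact: (@trigpoly_exp _ _ (fun j => centred (z 0 j))).
have phC z : trigpoly (fun k => (phase k z)^*).
  apply: eq_trigpoly (@trigpoly_exp _ _ (fun j => - centred (z 0 j))) => k.
  rewrite /phase -exp_miN -sumrN; congr exp_mi; apply: eq_bigr => l _.
  by rewrite rmorphN mulrN.
split.
  apply: (@eq_trigpoly _ _ (fun k => c * \sum_z phase k (z - x) * F x (mode z t) j)).
    by move=> k; rewrite mxE mul_fourier.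
  apply: trigpolyM; first exact: trigpoly_const.
  apply: trigpoly_sum => z; apply: trigpolyM; first exact: ph.
  exact: trigpoly_const.
apply: (@eq_trigpoly _ _ (fun k => c^* * \sum_z (phase k (z - x))^* * (F x (mode z t) j)^*)).
  move=> k; rewrite mxE mul_fourier rmorphM rmorph_sum; congr (_ * _).
  by apply: eq_bigr => z _; rewrite rmorphM.
apply: trigpolyM; first exact: trigpoly_const.
apply: trigpoly_sum => z; apply: trigpolyM; first exact: phC.
exact: trigpoly_const.
Qed.

Lemma lipschitz_fourier p (F : lattice L d -> 'M[R[i]]_(n, p)) (c : R[i]) :
  lipschitz_family (fun k x => c *: (fourier k x *m F x)).
Proof.
(* A crude bound for every entry of every [F x]. *)
pose S : R[i] := \sum_x \sum_i \sum_j `|F x i j|.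
have S0 : 0 <= S.
  by apply: sumr_ge0 => x _; apply: sumr_ge0 => i _; apply: sumr_ge0.
have FS x z t j : `|F x (mode z t) j| <= S.
  rewrite /S (bigD1 x) //= (bigD1 (mode z t)) //= (bigD1 j) //= -!addrA lerDl.
  rewrite !addr_ge0 //; first by apply: sumr_ge0.
    by apply: sumr_ge0 => i _; apply: sumr_ge0.
  by apply: sumr_ge0 => y _; apply: sumr_ge0 => i _; apply: sumr_ge0.
pose M : R[i] := `|c| * (#|{: lattice L d}|%:R * ((2 * d * L)%:R * S)).
have M0 : 0 <= M by rewrite !mulr_ge0.
(* [M] is a nonnegative element of [R[i]], while [lipschitz_family] asks for a constant in [R]. *)
exists (complex.Re M) => k k' x t j.
rewrite rmorphM /= RRe_real ?ger0_real // -scalerBr mxE.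
rewrite normrM -mulrA ler_wpM2l // mxE mul_fourier mxE mul_fourier -sumrB.
apply: le_trans (ler_norm_sum _ _ _) _.
rewrite -mulrA [leRHS]mulr_natl -sumr_const; apply: ler_sum => z _.
rewrite -mulrBl normrM mulrAC ler_pM //.
by apply: le_trans (phase_lipschitz L_gt1 _ _ _) _; rewrite rmorphM /= rmorph_nat.
Qed.

End Modes.

(** * Frustration-free Hamiltonians *)

Section Roots.
Variables (R : realType) (L d N r : nat).
Variables (h : lattice L d -> 'M[R[i]]_(nmodes L d N)) (C : lattice L d -> R).
Hypothesis hh : forall x, h x \is hermsymmx.
Hypothesis hr : forall x, has_range r x (h x).
Hypothesis hT : translation_invariant h C.
Hypothesis ff : frustration_free (local_term h C).
Local Notation F := (fun x => posroot (h x)).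
Local Notation G := (fun x => negroot (h x)).

(** Invariance of the Fock-space operator passes to the single-particle matrix that it
    determines. *)
Lemma total_translate a i j :
  (\sum_x h x) (translate_mode a i) (translate_mode a j) = (\sum_x h x) i j.
Proof.
have eqT : bilinear_op (fun i => annih R[i] (translate_mode a i))
      (\sum_x h x) (\sum_x ((C x)%:C)%C)
    = bilinear_op (@annih R[i] _) (\sum_x h x) (\sum_x ((C x)%:C)%C).
  by rewrite -(bilinear_op_sum (fun i => annih R[i] (translate_mode a i)))
    -(bilinear_op_sum (@annih R[i] _)); exact: hT a.
exact: (bilinear_op_relabel (@translate_mode_inj _ _ _ a) eqT).
Qed.

Lemma local_roots_orthogonal x y : (G x)^t* *m F y = 0.
Proof.
apply: negroot_posroot0 => // l m v w l0 m0 hv hw.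
exact: (frustration_free_orthogonal hh ff l0 m0 hv hw).
Qed.

Lemma gram_roots : gram F - gram G = \sum_x h x.
Proof. by rewrite -sumrB; apply: eq_bigr => x _; rewrite -hermsym_split. Qed.

(** The [h x] need not be translates of one another, but their sum is invariant; translating its
    orthogonal splitting gives another splitting of the same matrix. *)
Lemma translated_roots_orthogonal a x y :
  (\matrix_(i, j) G x (translate_mode a i) j)^t* *m F y = 0.
Proof.
apply: (@gram_split_relabel _ _ _ _ F G (translate_mode a)).
- exact: translate_mode_inj.
- by move=> i j; rewrite gram_roots; apply: total_translate.
- exact: local_roots_orthogonal.
Qed.

Lemma roots_range x z t : (r < torus_norm (z - x)%R)%N ->
  row (mode z t) (F x) = 0 /\ row (mode z t) (G x) = 0.
Proof.
move=> zx; apply: row_root_eq0 => //; apply/rowP => j; rewrite !mxE.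
by rewrite (modeE j); apply: hr; rewrite zx.
Qed.

(** The square of the prefactor cancels the number of sites in [bloch_average]. *)
Definition bloch_root (K : lattice L d -> 'M[R[i]]_(nmodes L d N)) (k : 'rV[R]_d) x :=
  sqrtC (#|{: lattice L d}|%:R^-1) *: (fourier N k x *m K x).

Hypothesis L_gt1 : (1 < L)%N.
Hypothesis rL : (4 * r < L)%N.

Lemma gram_bloch_root K k : gram (bloch_root K k) =
  #|{: lattice L d}|%:R^-1 *:
    \sum_x fourier N k x *m (K x *m (K x)^t*) *m (fourier N k x)^t*.
Proof.
have s2 : sqrtC (#|{: lattice L d}|%:R^-1) * (sqrtC (#|{: lattice L d}|%:R^-1))^*
    = #|{: lattice L d}|%:R^-1 :> R[i].
  by rewrite -normCK ger0_norm ?sqrtC_ge0 ?invr_ge0 ?ler0n // sqrtCK.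
rewrite scaler_sumr; apply: eq_bigr => x _.
by rewrite /bloch_root adjmxZ adjmxM -scalemxAl -scalemxAr scalerA s2 !mulmxA.
Qed.

Lemma bloch_gram (F G : lattice L d -> 'M[R[i]]_(nmodes L d N)) k :
  (forall x, h x = F x *m (F x)^t* - G x *m (G x)^t*) ->
  bloch h r k = gram (bloch_root F k) - gram (bloch_root G k).
Proof.
move=> hFG; have m0 : #|{: lattice L d}|%:R != 0 :> R[i].
  by rewrite pnatr_eq0 -lt0n; apply/card_gt0P; exists 0.
rewrite 2!gram_bloch_root -scalerBr -sumrB.
apply: (can_inj (scalerK m0)); rewrite scalerA mulfV // scale1r.
rewrite (bloch_average L_gt1 rL hr total_translate); apply: eq_bigr => x _.
by rewrite -mulmxBl -mulmxBr -hFG.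
Qed.

Lemma bloch_roots_orthogonal k x y : (bloch_root G k x)^t* *m bloch_root F k y = 0.
Proof.
rewrite /bloch_root adjmxZ -scalemxAl -scalemxAr.
rewrite (@fourier_orthogonal _ _ _ _ L_gt1 r _ F G) ?scaler0 //.
- exact: (fun x z t zx => (roots_range t zx).1).
- exact: (fun x z t zx => (roots_range t zx).2).
- exact: translated_roots_orthogonal.
Qed.

End Roots.

Theorem mainTheorem2 (R : realType) (d N L r : nat)
    (h : lattice L d -> 'M[R[i]]_(nmodes L d N)) (C : lattice L d -> R)
    (E : 'rV[R]_d -> 'I_N -> R) :
  (2 * (2 * r + 1) < L)%N ->
  (forall x, h x \is hermsymmx) ->
  (forall x, has_range r x (h x)) ->
  translation_invariant h C ->
  frustration_free (local_term h C) ->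
  (forall k, ordered_spectrum (bloch h r k) (E k)) ->
  forall n : 'I_N,
    ((forall k, 0 <= E k n) \/ (forall k, E k n <= 0)) /\
    (forall k0, E k0 n = 0 ->
       (fun k => E k n) =O_ k0 (fun k => `|k - k0| ^+ 2)).
Proof.
move=> rL hh hr hT ff spE n.
have L_gt1 : (1 < L)%N by lia.
have rL4 : (4 * r < L)%N by lia.
pose F := bloch_root (fun x => posroot (h x)).
pose G := bloch_root (fun x => negroot (h x)).
have GF k x y : (G k x)^t* *m F k y = 0 by exact: bloch_roots_orthogonal.
have spE' k : ordered_spectrum (gram (F k) - gram (G k)) (E k).
  rewrite -(bloch_gram hr hT L_gt1 rL4) // => x; exact: hermsym_split.
split.
  by apply: (one_signed_band _ _ _ GF spE'); apply: trigpoly_fourier.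
move=> k0 E0.
have [M HM] := quadratic_band (lipschitz_fourier L_gt1 _ _)
  (lipschitz_fourier L_gt1 _ _) GF spE' E0.
(* The bound holds for every [k], not just near [k0], so any constant above [M] works. *)
apply/eqOP; exists M; split; first exact: num_real.
move=> c Mc; apply: nearW => k; apply: le_trans (HM k) _.
by rewrite [X in _ <= _ * X]ger0_norm ?exprn_ge0 // ler_wpM2r ?exprn_ge0 // ltW.
Qed.
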